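(* Fix $N\geq 0$, constants $\mu_x,\mu_y,L_x,L_y,L_{xy}$ with $0\leq\mu_x\leq L_x$, $0\leq\mu_y\leq L_y$, $L_x,L_y>0$, $L_{xy}\geq 0$, a contraction factor $\rho\in[0,1]$, and the coefficients of a memory-$N$ method $\mathcal{A}$ satisfying the normalization conditions (all described in the context). If the semidefinite feasibility problem (Lyap-SDP) described in the context is feasible, then there exists a quadratic Lyapunov function of the form $$\mathcal{V}(\xi_k)=\begin{bmatrix}\mathbf{x}_k\\ \mathbf{g}^x_k\\ \mathbf{h}^x_k\end{bmatrix}^\top(P_x\otimes \mathcal{I}_{d_x})\begin{bmatrix}\mathbf{x}_k\\ \mathbf{g}^x_k\\ \mathbf{h}^x_k\end{bmatrix}+\begin{bmatrix}\mathbf{y}_k\\ \mathbf{g}^y_k\\ \mathbf{h}^y_k\end{bmatrix}^\top(P_y\otimes \mathcal{I}_{d_y})\begin{bmatrix}\mathbf{y}_k\\ \mathbf{g}^y_k\\ \mathbf{h}^y_k\end{bmatrix}+p_x^\top\mathbf{f}^x_k+p_y^\top\mathbf{f}^y_k\qquad(k\geq N)$$ with contraction $\rho$ that is valid for all $d_x,d_y\in\mathbb{N}$. That is, there exist symmetric $P_x,P_y\in\mathbb{R}^{3(N+1)\times 3(N+1)}$ and $p_x,p_y\in\mathbb{R}^{N+1}$ such that, for all $d_x,d_y\in\mathbb{N}$, on the states $\xi_k$ ($k\geq N$) generated by $\mathcal{A}$ applied to normalized functions $f\in\mathcal{K}_{\mu_x,\mu_y,L_x,L_y,L_{xy}}$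 from arbitrary initial points: 1. $\mathcal{V}(\xi_k)\geq 0$; 2. $\mathcal{V}(\xi_k)=0$ if and only if $\xi_k=0$; 3. $\mathcal{V}(\xi)\to\infty$ as $\|\xi\|\to\infty$ over such states; 4. $\mathcal{V}(\xi_{k+1})\leq\rho^2\,\mathcal{V}(\xi_k)$ for all $k\geq N$.
   Context: **Function class.** $\mathcal{F}_{\mu,L}$ is the class of differentiable $p:\mathbb{R}^d\to\mathbb{R}$ with $p-\frac{\mu}{2}\|\cdot\|_2^2$ convex and $\nabla p$ $L$-Lipschitz. $\mathcal{K}_{\mu_x,\mu_y,L_x,L_y,L_{xy}}$ is the class of $f(x,y)=p(x)+y^\top Ax-q(y)$ on $\mathbb{R}^{d_x}\times\mathbb{R}^{d_y}$ with $p\in\mathcal{F}_{\mu_x,L_x}$, $q\in\mathcal{F}_{\mu_y,L_y}$, $A\in\mathbb{R}^{d_y\times d_x}$, $\sigma_{\max}(A)\leq L_{xy}$. The problem is $\min_x\max_y f(x,y)$. Standing normalization: $f$ has a saddle point $(x_*,y_* )=(0,0)$, with $g^x_*=\nabla p(0)=0$, $g^y_*=\nabla q(0)=0$, $h^x_*=0$, $h^y_*=0$, $f^x_*=p(0)=0$, $f^y_*=q(0)=0$. **Method $\mathcal{A}$ (memory $N$).** Given $x_{-N},\dots,x_0\in\mathbb{R}^{d_x}$ and $y_{-N},\dots,y_0\in\mathbb{R}^{d_y}$, for $k=0,1,2,\dots$: $$u^x_k=\sum_{j=0}^N\theta^x_jx_{k-j},\quad v^y_k=\sum_{j=0}^N\phi^y_jy_{k-j},\quad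 g^x_k=\nabla p(u^x_k),\quad h^x_k=A^\top v^y_k,$$ $$x_{k+1}=\sum_{j=0}^N\alpha^x_jx_{k-j}-\beta^xg^x_k-\gamma^xh^x_k,$$ $$u^y_k=\sum_{j=0}^N\theta^y_jy_{k-j},\quad v^x_k=\sum_{j=0}^{N+1}\phi^x_jx_{k+1-j},\quad g^y_k=\nabla q(u^y_k),\quad h^y_k=Av^x_k,$$ $$y_{k+1}=\sum_{j=0}^N\alpha^y_jy_{k-j}-\beta^yg^y_k+\gamma^yh^y_k,$$ with real coefficients satisfying $\sum_j\theta^x_j=\sum_j\theta^y_j=\sum_j\phi^x_j=\sum_j\phi^y_j=\sum_j\alpha^x_j=\sum_j\alpha^y_j=1$. Put $f^x_k=p(u^x_k)$, $f^y_k=q(u^y_k)$. **State.** For $k\geq N$, $\mathbf{x}_k=[(x_k-x_* )^\top,\dots,(x_{k-N}-x_* )^\top]^\top$, $\mathbf{g}^x_k=[(g^x_k-g^x_* )^\top,\dots,(g^x_{k-N}-g^x_* )^\top]^\top$, $\mathbf{h}^x_k=[(h^x_k-h^x_* )^\top,\dots,(h^x_{k-N}-h^x_* )^\top]^\top$, $\mathbf{f}^x_k=[f^x_k-f^x_*,\dots,f^x_{k-N}-f^x_*]^\top$, and $\mathbf{y}_k,\mathbf{g}^y_k,\mathbf{h}^y_k,\mathbf{f}^y_k$ analogously. The state is $\xi_k=(\mathbf{x}_k,\mathbf{g}^x_k,\mathbf{f}^x_k,\mathbf{h}^x_k,\mathbf{y}_k,\mathbf{g}^y_k,\mathbf{f}^y_k,\mathbf{h}^y_k)$.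 $\mathcal{I}_d$ is the $d\times d$ identity. **Row basis vectors.** For $K\in\{N,N+1\}$, with $\overline e_i$ the $i$-th unit (column) vector of the appropriate dimension, define row vectors in $\mathbb{R}^{N+2K+3}$: $\overline x^{(K)}_k=\overline y^{(K)}_k=\overline e_{k+N+1}^\top$ for $k=-N,\dots,0$; $\overline g^{x(K)}_k=\overline g^{y(K)}_k=\overline e_{k+N+2}^\top$ and $\overline h^{x(K)}_k=\overline h^{y(K)}_k=\overline e_{k+K+N+3}^\top$ for $k=0,\dots,K$; and row vectors in $\mathbb{R}^{K+1}$: $\overline f^{x(K)}_k=\overline f^{y(K)}_k=\overline e_{k+1}^\top$ for $k=0,\dots,K$. All vectors with index $*$ (including $\overline u^{x(K)}_*,\overline u^{y(K)}_*$) are zero. For $k=0,\dots,K$ the vectors $\overline u^{x(K)}_k,\overline v^{y(K)}_k,\overline x^{(K)}_{k+1},\overline u^{y(K)}_k,\overline v^{x(K)}_k,\overline y^{(K)}_{k+1}$ are defined by the same linear recursions as in $\mathcal{A}$, with every quantity replaced by its barred version (the barred $g$ and $h$ being the unit vectors above). **Interpolation matrices.** Let $$M(\mu,L)=\frac12\begin{bmatrix}-\mu L&\mu L&\mu&-L\\ \mu L&-\mu L&-\mu&L\\ \mu&-\mu&-1&1\\ -L&L&1&-1\end{bmatrix}.$$ Let $I_K=\{0,1,\dots,K,*\}$. For $i,j\in I_K$ let $m^{x(K)}_{ij}=(L_x-\mu_x)(\overline f^{x(K)}_i-\overline f^{x(K)}_j)^\top\in\mathbb{R}^{K+1}$ and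 $M^{x(K)}_{ij}=S^\top M(\mu_x,L_x)S$, where $S$ is the matrix with rows $\overline u^{x(K)}_i,\overline u^{x(K)}_j,\overline g^{x(K)}_i,\overline g^{x(K)}_j$. Define $m^{y(K)}_{ij},M^{y(K)}_{ij}$ analogously with $y$ in place of $x$. Let $B^{(K)}_{Hx},B^{(K)}_{Hy},B^{(K)}_{vx},B^{(K)}_{vy}\in\mathbb{R}^{(N+2K+3)\times(K+1)}$ have columns $(\overline h^{x(K)}_k)^\top$, $(\overline h^{y(K)}_k)^\top$, $(\overline v^{x(K)}_k)^\top$, $(\overline v^{y(K)}_k)^\top$, $k=0,\dots,K$, respectively. **Lyapunov matrices.** Let $\overline{\mathbf{x}}^{(K)}_k$ be the matrix with rows $\overline x^{(K)}_k,\dots,\overline x^{(K)}_{k-N}$, and similarly $\overline{\mathbf{g}}^{x(K)}_k,\overline{\mathbf{h}}^{x(K)}_k,\overline{\mathbf{f}}^{x(K)}_k$ and the $y$-versions. Set $v^{x(K)}_k=(\overline{\mathbf{f}}^{x(K)}_k)^\top p_x$, $v^{y(K)}_k=(\overline{\mathbf{f}}^{y(K)}_k)^\top p_y\in\mathbb{R}^{K+1}$, and $$\mathcal{V}^{x(K)}_k=\begin{bmatrix}\overline{\mathbf{x}}^{(K)}_k\\ \overline{\mathbf{g}}^{x(K)}_k\\ \overline{\mathbf{h}}^{x(K)}_k\end{bmatrix}^\top P_x\begin{bmatrix}\overline{\mathbf{x}}^{(K)}_k\\ \overline{\mathbf{g}}^{x(K)}_k\\ \overline{\mathbf{h}}^{x(K)}_k\end{bmatrix},\qquad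 \mathcal{V}^{y(K)}_k=\begin{bmatrix}\overline{\mathbf{y}}^{(K)}_k\\ \overline{\mathbf{g}}^{y(K)}_k\\ \overline{\mathbf{h}}^{y(K)}_k\end{bmatrix}^\top P_y\begin{bmatrix}\overline{\mathbf{y}}^{(K)}_k\\ \overline{\mathbf{g}}^{y(K)}_k\\ \overline{\mathbf{h}}^{y(K)}_k\end{bmatrix}.$$ Let $\delta v^{x(K)}_k=v^{x(K)}_{k+1}-\rho^2v^{x(K)}_k$, $\delta\mathcal{V}^{x(K)}_k=\mathcal{V}^{x(K)}_{k+1}-\rho^2\mathcal{V}^{x(K)}_k$, and similarly for $y$. **(Lyap-SDP).** Find symmetric $P_x,P_y$ of size $3(N+1)$, $p_x,p_y\in\mathbb{R}^{N+1}$, symmetric $C_1,C_2,C_3$ of size $N+1$, symmetric $F_1,F_2,F_3$ of size $N+2$, reals $\lambda_{ij},\overline\lambda_{ij}\geq0$ ($i,j\in I_N$) and $\eta_{ij},\overline\eta_{ij}\geq0$ ($i,j\in I_{N+1}$), with $C_2,C_3,F_2,F_3\succeq0$, such that $$0\prec\mathcal{V}^{x(N)}_N-\sum_{i,j\in I_N}\lambda_{ij}M^{x(N)}_{ij}+B^{(N)}_{vx}C_1B^{(N)\top}_{Hx}+B^{(N)}_{Hx}C_2B^{(N)\top}_{Hx}-L_{xy}^2B^{(N)}_{vx}C_3B^{(N)\top}_{vx},$$ $$0\prec\mathcal{V}^{y(N)}_N-\sum_{i,j\in I_N}\overline\lambda_{ij}M^{y(N)}_{ij}-B^{(N)}_{Hy}C_1B^{(N)\top}_{vy}-L_{xy}^2B^{(N)}_{vy}C_2B^{(N)\top}_{vy}+B^{(N)}_{Hy}C_3B^{(N)\top}_{Hy},$$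 $$0<v^{x(N)}_N-\sum_{i,j\in I_N}\lambda_{ij}m^{x(N)}_{ij},\qquad 0<v^{y(N)}_N-\sum_{i,j\in I_N}\overline\lambda_{ij}m^{y(N)}_{ij},$$ $$0\succeq\delta\mathcal{V}^{x(N+1)}_N+\sum_{i,j\in I_{N+1}}\eta_{ij}M^{x(N+1)}_{ij}-B^{(N+1)}_{vx}F_1B^{(N+1)\top}_{Hx}-B^{(N+1)}_{Hx}F_2B^{(N+1)\top}_{Hx}+L_{xy}^2B^{(N+1)}_{vx}F_3B^{(N+1)\top}_{vx},$$ $$0\succeq\delta\mathcal{V}^{y(N+1)}_N+\sum_{i,j\in I_{N+1}}\overline\eta_{ij}M^{y(N+1)}_{ij}+B^{(N+1)}_{Hy}F_1B^{(N+1)\top}_{vy}+L_{xy}^2B^{(N+1)}_{vy}F_2B^{(N+1)\top}_{vy}-B^{(N+1)}_{Hy}F_3B^{(N+1)\top}_{Hy},$$ $$0\geq\delta v^{x(N+1)}_N+\sum_{i,j\in I_{N+1}}\eta_{ij}m^{x(N+1)}_{ij},\qquad 0\geq\delta v^{y(N+1)}_N+\sum_{i,j\in I_{N+1}}\overline\eta_{ij}m^{y(N+1)}_{ij}.$$ Vector inequalities are componentwise. A matrix inequality for a possibly non-symmetric square matrix $Z$ is understood through its quadratic form $z^\top Zz$ (equivalently, its symmetric part). *)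

(* Defs.v *)
From HB Require Import structures.
From mathcomp Require Import all_boot all_order all_algebra.
From mathcomp Require Import mxtens.
From mathcomp Require Import all_classical all_reals all_analysis.

Set Implicit Arguments.
Unset Strict Implicit.
Unset Printing Implicit Defensive.

Import Order.TTheory GRing.Theory Num.Theory.
Import numFieldNormedType.Exports.

Local Open Scope classical_set_scope.
Local Open Scope ring_scope.

(* The library norm `|x| on matrices is the sup norm; enorm is the Euclidean  *)
(* (Frobenius) norm.                                                          *)
Definition enorm (R : realType) (m n : nat) (A : 'M[R]_(m, n)) : R :=
  Num.sqrt (\sum_i \sum_j A i j ^+ 2).

Definition qform (R : realType) (n : nat) (Z : 'M[R]_n) (z : 'cV[R]_n) : R :=
  (z^T *m Z *m z) 0 0.

(* Definiteness refers to the quadratic form; Z need not be symmetric.        *)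
Definition posdef (R : realType) (n : nat) (Z : 'M[R]_n) : Prop :=
  forall z : 'cV[R]_n, z != 0 -> 0 < qform Z z.
Definition possemidef (R : realType) (n : nat) (Z : 'M[R]_n) : Prop :=
  forall z : 'cV[R]_n, 0 <= qform Z z.
Definition negsemidef (R : realType) (n : nat) (Z : 'M[R]_n) : Prop :=
  forall z : 'cV[R]_n, qform Z z <= 0.
Definition symmetric_mx (R : realType) (n : nat) (Z : 'M[R]_n) : Prop :=
  Z^T = Z.

(* The set of singular values is finite, so its sup is its maximum; it is     *)
(* empty only for n = 0, where sup gives 0.                                   *)
Definition sigma_max (R : realType) (m n : nat) (A : 'M[R]_(m, n)) : R :=
  sup [set s : R | 0 <= s /\ eigenvalue (A^T *m A) (s ^+ 2)].

Definition grad (R : realType) (d : nat) (p : 'cV[R]_d -> R) (x : 'cV[R]_d) :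
    'cV[R]_d :=
  \col_(i < d) 'D_(delta_mx i 0) p x.

Definition in_F (R : realType) (d : nat) (mu L : R) (p : 'cV[R]_d -> R) : Prop :=
  [/\ forall x, differentiable p x,
      @convex_function R 'cV[R]_d setT
        (fun x => p x - mu / 2 * enorm (x : 'cV[R]_d) ^+ 2)
    & forall x y, enorm (grad p x - grad p y) <= L * enorm (x - y)].

Definition saddle_fun (R : realType) (dx dy : nat) (p : 'cV[R]_dx -> R)
    (q : 'cV[R]_dy -> R) (A : 'M[R]_(dy, dx)) (x : 'cV[R]_dx) (y : 'cV[R]_dy) :
    R :=
  p x + (y^T *m A *m x) 0 0 - q y.

(* f = saddle_fun p q A is given by its components p, q, A, which the method  *)
(* accesses separately.                                                       *)
Definition in_K (R : realType) (dx dy : nat) (mux muy Lx Ly Lxy : R)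
    (p : 'cV[R]_dx -> R) (q : 'cV[R]_dy -> R) (A : 'M[R]_(dy, dx)) : Prop :=
  [/\ in_F mux Lx p, in_F muy Ly q & sigma_max A <= Lxy].

(* h_* = 0 needs no clause, since A^T 0 = 0 and A 0 = 0.                      *)
Definition normalized (R : realType) (dx dy : nat)
    (p : 'cV[R]_dx -> R) (q : 'cV[R]_dy -> R) (A : 'M[R]_(dy, dx)) : Prop :=
  [/\ forall x y, saddle_fun p q A 0 y <= saddle_fun p q A 0 0
                  /\ saddle_fun p q A 0 0 <= saddle_fun p q A x 0,
      grad p 0 = 0, grad q 0 = 0, p 0 = 0 & q 0 = 0].

Record method (R : realType) (N : nat) := Method {
  theta_x : 'I_N.+1 -> R;
  theta_y : 'I_N.+1 -> R;
  phi_x : 'I_N.+2 -> R;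
  phi_y : 'I_N.+1 -> R;
  alpha_x : 'I_N.+1 -> R;
  alpha_y : 'I_N.+1 -> R;
  beta_x : R;
  beta_y : R;
  gamma_x : R;
  gamma_y : R
}.

Definition coeffs_normalized (R : realType) (N : nat) (a : method R N) : Prop :=
  [/\ \sum_j theta_x a j = 1, \sum_j theta_y a j = 1 &
   [/\ \sum_j phi_x a j = 1, \sum_j phi_y a j = 1,
       \sum_j alpha_x a j = 1 & \sum_j alpha_y a j = 1]].

(* \sum_j c_j s_(k-j); sequences are indexed by int because the initial       *)
(* points have indices -N, ..., 0.                                            *)
Definition comb (R : realType) (V : lmodType R) (n : nat) (c : 'I_n -> R)
    (s : int -> V) (k : int) : V :=
  \sum_(j < n) c j *: s (k - j%:Z).

Section MethodSequences.
Context (R : realType) (N dx dy : nat) (a : method R N).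
Context (p : 'cV[R]_dx -> R) (q : 'cV[R]_dy -> R) (A : 'M[R]_(dy, dx)).
Context (x : int -> 'cV[R]_dx) (y : int -> 'cV[R]_dy).

Definition ux (k : int) : 'cV[R]_dx := comb (theta_x a) x k.
Definition uy (k : int) : 'cV[R]_dy := comb (theta_y a) y k.
Definition vx (k : int) : 'cV[R]_dx := comb (phi_x a) x (k + 1).
Definition vy (k : int) : 'cV[R]_dy := comb (phi_y a) y k.
Definition gx (k : int) : 'cV[R]_dx := grad p (ux k).
Definition gy (k : int) : 'cV[R]_dy := grad q (uy k).
Definition hx (k : int) : 'cV[R]_dx := A^T *m vy k.
Definition hy (k : int) : 'cV[R]_dy := A *m vx k.
Definition fx (k : int) : R := p (ux k).
Definition fy (k : int) : R := q (uy k).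

(* The initial points x_(-N), ..., x_0 and y_(-N), ..., y_0 are unconstrained *)
(* and the entries with index below -N are never read.                        *)
Definition is_run : Prop := forall k : nat,
  x (k%:Z + 1) = comb (alpha_x a) x k%:Z - beta_x a *: gx k%:Z
                 - gamma_x a *: hx k%:Z
  /\
  y (k%:Z + 1) = comb (alpha_y a) y k%:Z - beta_y a *: gy k%:Z
                 + gamma_y a *: hy k%:Z.

End MethodSequences.

Definition window (R : realType) (N n : nat) (s : int -> 'rV[R]_n) (k : int) :
    'M[R]_(N.+1, n) :=
  \matrix_(i < N.+1) s (k - i%:Z).

(* A stacked vector such as [x_k; ...; x_(k-N)] is stored as the matrix with  *)
(* rows x_k^T, ..., x_(k-N)^T, and stack recovers the column vector, with the *)
(* indexing used by the Kronecker product tensmx.                             *)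
Record state (R : realType) (N dx dy : nat) := State {
  st_x : 'M[R]_(N.+1, dx);
  st_gx : 'M[R]_(N.+1, dx);
  st_fx : 'cV[R]_N.+1;
  st_hx : 'M[R]_(N.+1, dx);
  st_y : 'M[R]_(N.+1, dy);
  st_gy : 'M[R]_(N.+1, dy);
  st_fy : 'cV[R]_N.+1;
  st_hy : 'M[R]_(N.+1, dy)
}.

Definition stack (R : realType) (m d : nat) (Z : 'M[R]_(m, d)) : 'cV[R]_(m * d) :=
  \col_i Z (mxtens_unindex i).1 (mxtens_unindex i).2.

Definition zero_state (R : realType) (N dx dy : nat) : state R N dx dy :=
  State 0 0 0 0 0 0 0 0.

Definition state_norm (R : realType) (N dx dy : nat) (xi : state R N dx dy) : R :=
  Num.sqrt (enorm (st_x xi) ^+ 2 + enorm (st_gx xi) ^+ 2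
            + enorm (st_fx xi) ^+ 2 + enorm (st_hx xi) ^+ 2
            + enorm (st_y xi) ^+ 2 + enorm (st_gy xi) ^+ 2
            + enorm (st_fy xi) ^+ 2 + enorm (st_hy xi) ^+ 2).

(* The values at the saddle point, which the state subtracts, are all zero by *)
(* the normalization of f.                                                    *)
Definition state_at (R : realType) (N dx dy : nat) (a : method R N)
    (p : 'cV[R]_dx -> R) (q : 'cV[R]_dy -> R) (A : 'M[R]_(dy, dx))
    (x : int -> 'cV[R]_dx) (y : int -> 'cV[R]_dy) (k : nat) :
    state R N dx dy :=
  State (window N (fun i => (x i)^T) k%:Z)
        (window N (fun i => (gx a p x i)^T) k%:Z)
        (\col_(j < N.+1) fx a p x (k%:Z - j%:Z))
        (window N (fun i => (hx a A y i)^T) k%:Z)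
        (window N (fun i => (y i)^T) k%:Z)
        (window N (fun i => (gy a q y i)^T) k%:Z)
        (\col_(j < N.+1) fy a q y (k%:Z - j%:Z))
        (window N (fun i => (hy a A x i)^T) k%:Z).

Definition stack3 (R : realType) (m n : nat) (X G H : 'M[R]_(m, n)) :
    'M[R]_(m + m + m, n) :=
  col_mx (col_mx X G) H.

Definition lyap_dim (N : nat) : nat := (N.+1 + N.+1 + N.+1)%N.

Definition lyapunov (R : realType) (N dx dy : nat)
    (Px Py : 'M[R]_(lyap_dim N)) (px py : 'cV[R]_N.+1) (xi : state R N dx dy) :
    R :=
  qform (tensmx Px (1%:M : 'M[R]_dx))
        (stack (stack3 (st_x xi) (st_gx xi) (st_hx xi)))
  + qform (tensmx Py (1%:M : 'M[R]_dy))
          (stack (stack3 (st_y xi) (st_gy xi) (st_hy xi)))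
  + (px^T *m st_fx xi) 0 0 + (py^T *m st_fy xi) 0 0.

Definition generated_state (R : realType) (N dx dy : nat)
    (mux muy Lx Ly Lxy : R) (a : method R N) : set (state R N dx dy) :=
  [set xi | exists (p : 'cV[R]_dx -> R) (q : 'cV[R]_dy -> R) (A : 'M[R]_(dy, dx))
                   (x : int -> 'cV[R]_dx) (y : int -> 'cV[R]_dy) (k : nat),
     [/\ in_K mux muy Lx Ly Lxy p q A, normalized p q A,
         is_run a p q A x y, (N <= k)%N & xi = state_at a p q A x y k]].

(* The sequence that agrees with init on indices <= 0 and satisfies           *)
(* s_(k+1) = comb c s k + w k for k >= 0 (lin_rec0 and lin_recS below).       *)
Fixpoint lin_rec_upto (R : realType) (V : lmodType R) (n : nat) (c : 'I_n -> R)
    (init w : int -> V) (k : nat) : int -> V :=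
  if k is k'.+1 then
    let s := lin_rec_upto c init w k' in
    fun i => if i == k'%:Z + 1 then comb c s k'%:Z + w k'%:Z else s i
  else init.

Definition lin_rec (R : realType) (V : lmodType R) (n : nat) (c : 'I_n -> R)
    (init w : int -> V) (i : int) : V :=
  lin_rec_upto c init w (absz i) i.

Lemma lin_rec_upto_le (R : realType) (V : lmodType R) (n : nat) (c : 'I_n -> R)
    (init w : int -> V) (k : nat) (i : int) :
  i <= k%:Z -> lin_rec_upto c init w k i = lin_rec c init w i.
Proof.
rewrite /lin_rec; case: i => [m|m] lemk; last first.
  have E k' : lin_rec_upto c init w k' (Negz m) = init (Negz m).
    by elim: k' => //= k' ->; rewrite -PoszD.
  by rewrite !E.
have {}lemk : (m <= k)%N by [].
rewrite absz_nat; elim: k lemk => [|k IHk]; first by rewrite leqn0 => /eqP ->.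
rewrite leq_eqVlt => /orP[/eqP -> //|]; rewrite ltnS => lemk /=.
by rewrite -PoszD addn1 eqz_nat ltn_eqF ?ltnS // IHk.
Qed.

Lemma lin_rec0 (R : realType) (V : lmodType R) (n : nat) (c : 'I_n -> R)
    (init w : int -> V) (i : int) : i <= 0 -> lin_rec c init w i = init i.
Proof. by move=> /(@lin_rec_upto_le _ _ _ c init w 0) <-. Qed.

Lemma lin_recS (R : realType) (V : lmodType R) (n : nat) (c : 'I_n -> R)
    (init w : int -> V) (k : nat) :
  lin_rec c init w (k%:Z + 1) = comb c (lin_rec c init w) k%:Z + w k%:Z.
Proof.
rewrite {1}/lin_rec -PoszD addn1 absz_nat /= -PoszD addn1 eqxx.
congr (_ + _); apply: eq_bigr => j _.
by rewrite lin_rec_upto_le // lerBlDr lerDl.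
Qed.

(* e_(i+1)^T: positions are counted from 0.                                   *)
Definition unit_row (R : realType) (n i : nat) : 'rV[R]_n :=
  \row_(j < n) ((j : nat) == i)%:R.

Section BarredVectors.
Context (R : realType) (N : nat) (a : method R N) (K : nat).

Definition bar_dim : nat := (N + 2 * K + 3)%N.

(* These unit vectors are shared by the x and y systems. They are only read   *)
(* for indices -N <= k <= 0 (initial points) and 0 <= k <= K (g, h, f).       *)
Definition init_bar (k : int) : 'rV[R]_bar_dim := unit_row R bar_dim (absz (k + N%:Z)).
Definition g_bar (k : int) : 'rV[R]_bar_dim := unit_row R bar_dim (absz k + N + 1)%N.
Definition h_bar (k : int) : 'rV[R]_bar_dim :=
  unit_row R bar_dim (absz k + K + N + 2)%N.
Definition f_bar (k : int) : 'rV[R]_K.+1 := unit_row R K.+1 (absz k).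

Definition x_bar : int -> 'rV[R]_bar_dim :=
  lin_rec (alpha_x a) init_bar
    (fun k => - (beta_x a *: g_bar k) - gamma_x a *: h_bar k).
Definition y_bar : int -> 'rV[R]_bar_dim :=
  lin_rec (alpha_y a) init_bar
    (fun k => - (beta_y a *: g_bar k) + gamma_y a *: h_bar k).

Definition ux_bar (k : int) : 'rV[R]_bar_dim := comb (theta_x a) x_bar k.
Definition uy_bar (k : int) : 'rV[R]_bar_dim := comb (theta_y a) y_bar k.
Definition vx_bar (k : int) : 'rV[R]_bar_dim := comb (phi_x a) x_bar (k + 1).
Definition vy_bar (k : int) : 'rV[R]_bar_dim := comb (phi_y a) y_bar k.

(* The index set {0, ..., K, *}, with None for *.                             *)
Definition idx : finType := option 'I_K.+1.

Definition at_idx (n : nat) (s : int -> 'rV[R]_n) (i : idx) : 'rV[R]_n :=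
  if i is Some k then s (k : nat)%:Z else 0.

Definition M_mx (mu L : R) : 'M[R]_4 :=
  2^-1 *: \matrix_(r < 4, c < 4)
    nth 0 (nth [::]
      [:: [:: - (mu * L);    mu * L ;   mu;  - L];
          [::    mu * L ; - (mu * L); - mu;    L];
          [::    mu     ; - mu      ; - 1 ;    1];
          [:: - L       ;   L       ;   1 ;  - 1]] r) c.

Definition interp_m (mu L : R) (i j : idx) : 'cV[R]_K.+1 :=
  (L - mu) *: (at_idx f_bar i - at_idx f_bar j)^T.

Definition interp_M (mu L : R) (u : int -> 'rV[R]_bar_dim) (i j : idx) :
    'M[R]_bar_dim :=
  let S : 'M[R]_(4, bar_dim) := \matrix_(r < 4)
    nth 0 [:: at_idx u i; at_idx u j; at_idx g_bar i; at_idx g_bar j] r in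
  S^T *m M_mx mu L *m S.

Definition B_mx (s : int -> 'rV[R]_bar_dim) : 'M[R]_(bar_dim, K.+1) :=
  (\matrix_(k < K.+1) s (k : nat)%:Z)^T.

Definition B_H : 'M[R]_(bar_dim, K.+1) := B_mx h_bar.
Definition B_vx : 'M[R]_(bar_dim, K.+1) := B_mx vx_bar.
Definition B_vy : 'M[R]_(bar_dim, K.+1) := B_mx vy_bar.

Definition V_bar (P : 'M[R]_(lyap_dim N)) (s : int -> 'rV[R]_bar_dim) (k : int) :
    'M[R]_bar_dim :=
  let W := stack3 (window N s k) (window N g_bar k) (window N h_bar k) in
  W^T *m P *m W.

Definition v_bar (p : 'cV[R]_N.+1) (k : int) : 'cV[R]_K.+1 :=
  (window N f_bar k)^T *m p.

Definition delta_V (rho : R) (P : 'M[R]_(lyap_dim N))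
    (s : int -> 'rV[R]_bar_dim) (k : int) : 'M[R]_bar_dim :=
  V_bar P s (k + 1) - rho ^+ 2 *: V_bar P s k.

Definition delta_v (rho : R) (p : 'cV[R]_N.+1) (k : int) : 'cV[R]_K.+1 :=
  v_bar p (k + 1) - rho ^+ 2 *: v_bar p k.

Definition positivity_constraints (mux muy Lx Ly Lxy : R)
    (Px Py : 'M[R]_(lyap_dim N)) (px py : 'cV[R]_N.+1)
    (C1 C2 C3 : 'M[R]_K.+1) (lam lamb : idx -> idx -> R) : Prop :=
  [/\ posdef (V_bar Px x_bar N%:Z
        - \sum_i \sum_j lam i j *: interp_M mux Lx ux_bar i j
        + B_vx *m C1 *m B_H^T + B_H *m C2 *m B_H^T
        - Lxy ^+ 2 *: (B_vx *m C3 *m B_vx^T)),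
      posdef (V_bar Py y_bar N%:Z
        - \sum_i \sum_j lamb i j *: interp_M muy Ly uy_bar i j
        - B_H *m C1 *m B_vy^T - Lxy ^+ 2 *: (B_vy *m C2 *m B_vy^T)
        + B_H *m C3 *m B_H^T),
      forall r, 0 < (v_bar px N%:Z
        - \sum_i \sum_j lam i j *: interp_m mux Lx i j) r 0
    & forall r, 0 < (v_bar py N%:Z
        - \sum_i \sum_j lamb i j *: interp_m muy Ly i j) r 0].

Definition decrease_constraints (mux muy Lx Ly Lxy rho : R)
    (Px Py : 'M[R]_(lyap_dim N)) (px py : 'cV[R]_N.+1)
    (F1 F2 F3 : 'M[R]_K.+1) (eta etab : idx -> idx -> R) : Prop :=
  [/\ negsemidef (delta_V rho Px x_bar N%:Z
        + \sum_i \sum_j eta i j *: interp_M mux Lx ux_bar i j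
        - B_vx *m F1 *m B_H^T - B_H *m F2 *m B_H^T
        + Lxy ^+ 2 *: (B_vx *m F3 *m B_vx^T)),
      negsemidef (delta_V rho Py y_bar N%:Z
        + \sum_i \sum_j etab i j *: interp_M muy Ly uy_bar i j
        + B_H *m F1 *m B_vy^T + Lxy ^+ 2 *: (B_vy *m F2 *m B_vy^T)
        - B_H *m F3 *m B_H^T),
      forall r, (delta_v rho px N%:Z
        + \sum_i \sum_j eta i j *: interp_m mux Lx i j) r 0 <= 0
    & forall r, (delta_v rho py N%:Z
        + \sum_i \sum_j etab i j *: interp_m muy Ly i j) r 0 <= 0].

End BarredVectors.

Definition lyap_sdp_feasible (R : realType) (N : nat)
    (mux muy Lx Ly Lxy rho : R) (a : method R N) : Prop :=
  exists (Px Py : 'M[R]_(lyap_dim N)) (px py : 'cV[R]_N.+1)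
         (C1 C2 C3 : 'M[R]_N.+1) (F1 F2 F3 : 'M[R]_N.+2)
         (lam lamb : idx N -> idx N -> R)
         (eta etab : idx N.+1 -> idx N.+1 -> R),
  [/\ symmetric_mx Px /\ symmetric_mx Py,
      [/\ symmetric_mx C1, symmetric_mx C2, symmetric_mx C3,
          possemidef C2 & possemidef C3],
      [/\ symmetric_mx F1, symmetric_mx F2, symmetric_mx F3,
          possemidef F2 & possemidef F3],
      (forall i j, 0 <= lam i j /\ 0 <= lamb i j) /\
      (forall i j, 0 <= eta i j /\ 0 <= etab i j) &
      positivity_constraints a mux muy Lx Ly Lxy Px Py px py C1 C2 C3 lam lamb
      /\
      decrease_constraints a mux muy Lx Ly Lxy rho Px Py px py F1 F2 F3 eta etab].

(* Main.v *)
(* Fix [K] and a time [s].  Stacking the vectors x_(s-N), ..., x_s,              *)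
(* g_s, ..., g_(s+K), h_s, ..., h_(s+K) as the rows of a matrix Xi, linearity   *)
(* of the method makes every barred row vector r_j satisfy r_j Xi = r_(s+j)^T,  *)
(* so that a matrix inequality for Z bounds tr (Xi^T Z Xi), in any dimension.   *)
(* Evaluating the positivity constraints (K = N) and the decrease constraints   *)
(* (K = N + 1) in this way and adding the x and y parts, the lam, eta terms     *)
(* have a sign by the interpolation inequality, the C1, F1 terms of x and y     *)
(* cancel since <v^x, A^T v^y> = <A v^x, v^y>, and the C2, C3, F2, F3 terms     *)
(* have a sign because Lxy^2 - A A^T and Lxy^2 - A^T A are positive             *)
(* semidefinite.  Strict positive definiteness bounds |Xi|^2 and the            *)
(* (nonnegative) function values linearly by the Lyapunov function, which gives *)
(* definiteness and coercivity.                                                 *)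
Require Import Defs.
From mathcomp Require Import all_boot all_order all_algebra.
From mathcomp Require Import mxtens ring lra zify.
From mathcomp Require Import all_classical all_reals all_analysis.

Set Implicit Arguments.
Unset Strict Implicit.
Unset Printing Implicit Defensive.

Import Order.TTheory GRing.Theory Num.Theory.
Import numFieldNormedType.Exports.

Local Open Scope classical_set_scope.
Local Open Scope ring_scope.

(** The method is linear in its past iterates, gradients and coupling terms. Hence a window of any
    trajectory is the image, under matrices depending only on the coefficients, of one matrix of
    generating vectors ([lift_mx], [x_bar_lift], [y_bar_lift]). The dimension enters only through
    the number of columns of that matrix: [trq Z] is the sum of [qform Z] over the columns, so a
    matrix inequality of fixed size holds in every dimension, and [qform_tens_stack] identifies
    [trq] with the Kronecker form.

    The rest is an S-procedure. Membership in the function class is used only through inequalities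
    with multipliers: [smooth_convex_interpolation] for [p] and [q], and the norm bounds on [A] and
    its transpose, gathered in [coupling_sum_le0]. By these, the certified forms lie below the
    Lyapunov function ([positivity_lower_bound]) and above its weighted decrement
    ([decrease_upper_bound]).

    Nonstrict signs suffice for the decrease. For positivity, [posdef_coercive] turns strict
    definiteness into a bound whose constant is free of the dimension, and [lyapunov_coercive]
    bounds the squared state norm by [b * V + c * V ^+ 2]. This gives nonnegativity, definiteness
    and growth at infinity together. *)

(** * Quadratic forms, the Frobenius inner product and semidefinite factorization *)

Lemma qformDmx (R : realType) (n : nat) (Z Z' : 'M[R]_n) (z : 'cV[R]_n) :
  qform (Z + Z') z = qform Z z + qform Z' z.
Proof. by rewrite /qform mulmxDr mulmxDl mxE. Qed.

Lemma qform_tr (R : realType) (n : nat) (Z : 'M[R]_n) (z : 'cV[R]_n) :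
  qform Z^T z = qform Z z.
Proof.
have tr11 (M : 'M[R]_1) : M^T 0 0 = M 0 0 by rewrite mxE.
by rewrite /qform -[LHS]tr11 !trmx_mul !trmxK mulmxA.
Qed.

Lemma enorm_sqr (R : realType) (m n : nat) (X : 'M[R]_(m, n)) :
  enorm X ^+ 2 = \sum_i \sum_j X i j ^+ 2.
Proof.
rewrite sqr_sqrtr // !sumr_ge0 // => i _.
by rewrite sumr_ge0 // => j _; rewrite sqr_ge0.
Qed.

Lemma enorm_ge0 (R : realType) (m n : nat) (X : 'M[R]_(m, n)) : 0 <= enorm X.
Proof. exact: sqrtr_ge0. Qed.

Definition ip (R : realType) (m n : nat) (X Y : 'M[R]_(m, n)) : R := \tr (X^T *m Y).

Section InnerProduct.
Context (R : realType) (m n : nat).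
Implicit Types (X Y Z : 'M[R]_(m, n)) (t : R).

Lemma ip_sum X Y : ip X Y = \sum_i \sum_j X i j * Y i j.
Proof.
rewrite /ip exchange_big /=; apply: eq_bigr => j _; rewrite mxE.
by apply: eq_bigr => i _; rewrite mxE.
Qed.

Lemma ipC X Y : ip X Y = ip Y X.
Proof. by rewrite /ip -mxtrace_tr trmx_mul trmxK. Qed.

Lemma ipDr X Y Z : ip X (Y + Z) = ip X Y + ip X Z.
Proof. by rewrite /ip mulmxDr mxtraceD. Qed.

Lemma ipDl X Y Z : ip (Y + Z) X = ip Y X + ip Z X.
Proof. by rewrite ipC ipDr !(ipC X). Qed.

Lemma ipNr X Y : ip X (- Y) = - ip X Y.
Proof. by rewrite /ip mulmxN raddfN. Qed.

Lemma ipNl X Y : ip (- Y) X = - ip Y X.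
Proof. by rewrite ipC ipNr ipC. Qed.

Lemma ipZr t X Y : ip X (t *: Y) = t * ip X Y.
Proof. by rewrite /ip -scalemxAr mxtraceZ. Qed.

Lemma ipZl t X Y : ip (t *: Y) X = t * ip Y X.
Proof. by rewrite ipC ipZr ipC. Qed.

End InnerProduct.

Definition ipE := (ipDr, ipDl, ipNr, ipNl, ipZr, ipZl).

Lemma enorm_sqr_ip (R : realType) (m n : nat) (X : 'M[R]_(m, n)) :
  enorm X ^+ 2 = ip X X.
Proof.
rewrite enorm_sqr ip_sum.
by apply: eq_bigr => i _; apply: eq_bigr => j _; rewrite expr2.
Qed.

Lemma enorm_trmx (R : realType) (m n : nat) (X : 'M[R]_(m, n)) :
  enorm X^T = enorm X.
Proof.
rewrite /enorm exchange_big /=; congr Num.sqrt.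
by apply: eq_bigr => i _; apply: eq_bigr => j _; rewrite mxE.
Qed.

Lemma enorm_sqr_eq0 (R : realType) (m n : nat) (X : 'M[R]_(m, n)) :
  enorm X ^+ 2 = 0 -> X = 0.
Proof.
rewrite enorm_sqr => /eqP; rewrite psumr_eq0 => [/allP X0|i _]; last first.
  by rewrite sumr_ge0 // => j _; rewrite sqr_ge0.
apply/matrixP => i j; have /eqP := X0 i (mem_index_enum _).
move=> /eqP; rewrite psumr_eq0 => [/allP /(_ j (mem_index_enum _))|k _].
  by rewrite sqrf_eq0 mxE => /eqP.
exact: sqr_ge0.
Qed.

(** The squared norm of [enorm Y ^+ 2 *: X - ip X Y *: Y] is [enorm Y ^+ 2] times the gap between
    the two sides. *)
Lemma cauchy_schwarz (R : realType) (m n : nat) (X Y : 'M[R]_(m, n)) :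
  ip X Y ^+ 2 <= enorm X ^+ 2 * enorm Y ^+ 2.
Proof.
have [Y0|Yn0] := eqVneq (enorm Y ^+ 2) 0.
  by rewrite Y0 mulr0 (enorm_sqr_eq0 Y0) /ip mulmx0 mxtrace0 expr0n.
have Yp : 0 < enorm Y ^+ 2 by rewrite lt_neqAle eq_sym Yn0 sqr_ge0.
have := sqr_ge0 (enorm (enorm Y ^+ 2 *: X - ip X Y *: Y)).
rewrite [enorm (_ - _) ^+ 2]enorm_sqr_ip !ipE (ipC Y X) -!enorm_sqr_ip => ge0.
rewrite -subr_ge0 -(pmulr_rge0 _ Yp); apply: le_trans ge0 _.
by rewrite le_eqVlt; apply/orP; left; apply/eqP; ring.
Qed.

Lemma ip_le (R : realType) (m n : nat) (X Y : 'M[R]_(m, n)) :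
  ip X Y <= enorm X * enorm Y.
Proof.
have nn : 0 <= enorm X * enorm Y by rewrite mulr_ge0 ?enorm_ge0.
apply: le_trans (ler_norm _) _.
rewrite -ler_sqr ?nnegrE ?normr_ge0 // real_normK ?num_real // exprMn.
exact: cauchy_schwarz.
Qed.

Lemma enorm_mulmx_sqr (R : realType) (m n p : nat) (X : 'M[R]_(m, n))
    (Y : 'M[R]_(n, p)) :
  enorm (X *m Y) ^+ 2 <= enorm X ^+ 2 * enorm Y ^+ 2.
Proof.
rewrite -(enorm_trmx Y) !enorm_sqr mulr_suml ler_sum // => i _.
rewrite mulr_sumr ler_sum // => j _.
have := cauchy_schwarz (row i X)^T (col j Y).
have -> : ip (row i X)^T (col j Y) = (X *m Y) i j.
  by rewrite /ip trmxK /mxtrace big_ord1 !mxE; apply: eq_bigr => k _; rewrite !mxE.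
congr (_ <= _ * _); rewrite enorm_sqr.
  rewrite exchange_big big_ord1 /=; apply: eq_bigr => k _; first by rewrite !mxE.
by apply: eq_bigr => k _; rewrite big_ord1 !mxE.
Qed.

(** If [b] were nonzero, the chosen [t] would give the value -1. This settles the zero pivot in
    [psd_factor] and the case [mu = L] of the interpolation inequality. *)
Lemma linear_term_eq0 (R : realType) (b d : R) :
  (forall t, 0 <= t * b + d) -> b = 0.
Proof.
move=> H; apply/eqP/negPn/negP => b0; have := H (- (d + 1) / b).
by rewrite divfK //; lra.
Qed.

(** Cholesky factorization: split off the first coordinate, with pivot [c], and factor the Schur
    complement by induction. *)
Lemma psd_factor (R : realType) (n : nat) (C : 'M[R]_n) :
  symmetric_mx C -> possemidef C -> exists W : 'M[R]_n, C = W^T *m W.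
Proof.
elim: n C => [|n IHn] C Csym Cpsd.
  by exists 0; apply/matrixP => -[].
move: C Csym Cpsd; rewrite -[n.+1]/(1 + n)%N => C Csym Cpsd.
set c := ulsubmx C 0 0; set b := dlsubmx C; set D := drsubmx C.
have Dsym : D^T = D by rewrite trmx_drsub Csym.
have urb : ursubmx C = b^T by rewrite trmx_dlsub Csym.
have CE : C = block_mx c%:M b^T b D.
  by rewrite -[LHS]submxK urb -mx11_scalar.
have vbE (v : 'cV[R]_n) : v^T *m b = b^T *m v.
  by apply/matrixP => i j; rewrite !ord1 -[b^T *m v]trmxK trmx_mul trmxK [RHS]mxE.
have qE (t : R) (v : 'cV[R]_n) :
    qform C (col_mx t%:M v) =
    t ^+ 2 * c + 2 * t * (b^T *m v) 0 0 + qform D v.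
  rewrite /qform {1}CE tr_col_mx mul_row_block mul_row_col !mulmxDl.
  rewrite tr_scalar_mx !mul_scalar_mx !mul_mx_scalar -!scalemxAl vbE.
  move: (b^T *m v) (v^T *m D *m v) => w r.
  by rewrite !mxE eqxx !mulr1n; ring.
have c_ge0 : 0 <= c.
  by have := Cpsd (col_mx 1%:M 0); rewrite qE /qform !mulmx0 !mxE; lra.
(* With a zero pivot the form is affine in the first coordinate, so nonnegativity kills the
   off-diagonal column. *)
have b_eq0 : c = 0 -> b = 0.
  move=> c0; apply/matrixP => i j; rewrite (ord1 j) [RHS]mxE.
  have bi : (b^T *m delta_mx i (0 : 'I_1)) 0 0 = b i 0 by rewrite -colE !mxE.
  have H t : 0 <= t * (2 * b i 0) + qform D (delta_mx i 0).
    by have := Cpsd (col_mx t%:M (delta_mx i 0)); rewrite qE c0 bi; lra.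
  by have := linear_term_eq0 H; lra.
have [|v|W WE] := IHn (D - c^-1 *: (b *m b^T)).
- by rewrite /symmetric_mx linearB /= linearZ /= trmx_mul trmxK Dsym.
- set w := (b^T *m v) 0 0.
  (* This first coordinate minimizes the form for fixed [v], and the minimum is the Schur complement
     form. For [c = 0] the convention [0^-1 = 0] makes the same formulas valid. *)
  have := Cpsd (col_mx (- (c^-1 * w))%:M v); rewrite qE -/w.
  have -> : qform (D - c^-1 *: (b *m b^T)) v = qform D v - c^-1 * w ^+ 2.
    rewrite /qform mulmxBr mulmxBl -scalemxAr -scalemxAl mulmxA -(mulmxA _ b^T v).
    rewrite vbE /w; move: (b^T *m v) (v^T *m D *m v) => u r.
    by rewrite !mxE big_ord1.
  have [c0|cn0] := eqVneq c 0; first by rewrite c0 invr0; lra.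
  have -> : (- (c^-1 * w)) ^+ 2 * c + 2 * - (c^-1 * w) * w = - (c^-1 * w ^+ 2).
    by field.
  by rewrite addrC.
set s := Num.sqrt c.
have ss : s ^+ 2 = c by rewrite sqr_sqrtr.
exists (block_mx s%:M (s^-1 *: b^T) 0 W).
have sb : s *: (s^-1 *: b) = b.
  have [s0|sn0] := eqVneq s 0.
    by rewrite b_eq0 ?scaler0 // -ss s0 expr0n.
  by rewrite scalerA divff // scale1r.
rewrite (tr_block_mx s%:M) trmx0 mulmx_block mulmx0 !mul0mx !addr0.
rewrite tr_scalar_mx [(_ *: _)^T]linearZ /= trmxK mulmx0 addr0 -scalar_mxM mul_scalar_mx.
rewrite mul_mx_scalar sb -scalemxAl -scalemxAr [s^-1 *: (_ *: _)]scalerA -invfM -(expr2 s) ss.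
rewrite -WE addrC addrNK {1}CE.
by congr block_mx; rewrite -{1}sb; apply/matrixP => i j; rewrite !mxE.
Qed.

Lemma mxtrace_qform (R : realType) (n d : nat) (Z : 'M[R]_n) (X : 'M[R]_(n, d)) :
  \tr (X^T *m Z *m X) = \sum_j qform Z (col j X).
Proof.
apply: eq_bigr => j _; rewrite /qform tr_col -row_mul !mxE.
by apply: eq_bigr => i _; rewrite !mxE.
Qed.

(** Factor the symmetrization as [W^T *m W]. Definiteness makes [W] invertible, and the norm of
    [W *m X] controls that of [X]. The constant does not depend on the number [d] of columns, which
    is what makes the final bounds uniform in the dimension. *)
Lemma posdef_coercive (R : realType) (n : nat) (Z : 'M[R]_n) :
  posdef Z -> exists2 c, 0 < c &
    forall d (X : 'M[R]_(n, d)), c * enorm X ^+ 2 <= \tr (X^T *m Z *m X).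
Proof.
move=> Zpos; have qS z : qform (Z + Z^T) z = 2 * qform Z z.
  by rewrite qformDmx qform_tr; ring.
have [||W WE] := @psd_factor _ _ (Z + Z^T).
- by rewrite /symmetric_mx linearD /= trmxK addrC.
- move=> z; rewrite qS; have [->|/Zpos] := eqVneq z 0; last by lra.
  by rewrite /qform mulmx0 mxE mulr0.
have Wunit : W \in unitmx.
  rewrite -unitmx_tr -row_free_unit -kermx_eq0; apply/eqP/row_matrixP => i.
  rewrite row0; set r := row i _.
  have rW : r *m W^T = 0 by rewrite -row_mul mulmx_ker row0.
  have [//|rn0] := eqVneq r 0.
  exfalso; have := Zpos r^T; rewrite trmx_eq0 => /(_ rn0).
  have : 2 * qform Z r^T = 0.
    by rewrite -qS WE /qform trmxK mulmxA rW !mul0mx mxE.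
  by lra.
have K_ge0 := sqr_ge0 (enorm (invmx W)).
exists ((2 * (enorm (invmx W) ^+ 2 + 1))^-1) => [|d X].
  by rewrite invr_gt0; lra.
rewrite mulrC ler_pdivrMr; last by lra.
have -> : \tr (X^T *m Z *m X) = enorm (W *m X) ^+ 2 / 2.
  rewrite enorm_sqr_ip /ip trmx_mul -!mulmxA (mulmxA W^T) -WE !mulmxA.
  rewrite !mxtrace_qform; under [in RHS]eq_bigr do rewrite qS.
  by rewrite -mulr_sumr; field.
have := enorm_mulmx_sqr (invmx W) (W *m X); rewrite mulKmx //.
by have := sqr_ge0 (enorm (W *m X)); nra.
Qed.

(** With [C = W^T *m W], the trace is the sum of [qform Q] over the rows of [W *m V]. *)
Lemma psd_pairing_ge0 (R : realType) (m d : nat) (C : 'M[R]_m) (Q : 'M[R]_d)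
    (V : 'M[R]_(m, d)) :
  symmetric_mx C -> possemidef C -> possemidef Q ->
  0 <= \tr (V^T *m C *m V *m Q).
Proof.
move=> Csym Cpsd Qpsd; have [W ->] := psd_factor Csym Cpsd.
have -> : V^T *m (W^T *m W) *m V *m Q = (W *m V)^T *m (W *m V *m Q).
  by rewrite trmx_mul !mulmxA.
by rewrite mxtrace_mulC -[X in X *m Q]trmxK mxtrace_qform sumr_ge0.
Qed.

(** * Norm bounds for the coupling matrix from its largest singular value *)

Lemma enorm0 (R : realType) (m n : nat) : enorm (0 : 'M[R]_(m, n)) = 0.
Proof.
rewrite /enorm big1 ?sqrtr0 // => i _.
by rewrite big1 // => j _; rewrite mxE expr0n.
Qed.

Lemma enorm_sqr_gt0 (R : realType) (m n : nat) (X : 'M[R]_(m, n)) :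
  X != 0 -> 0 < enorm X ^+ 2.
Proof.
rewrite lt_neqAle sqr_ge0 andbT; apply: contra => /eqP.
by move=> /esym/enorm_sqr_eq0 ->.
Qed.

Lemma qform_scalar_mx (R : realType) (n : nat) (t : R) (z : 'cV[R]_n) :
  qform t%:M z = t * enorm z ^+ 2.
Proof.
by rewrite enorm_sqr_ip /ip /mxtrace big_ord1 /qform mul_mx_scalar -scalemxAl mxE.
Qed.

Lemma qform_opp (R : realType) (n : nat) (Z : 'M[R]_n) (z : 'cV[R]_n) :
  qform (- Z) z = - qform Z z.
Proof. by rewrite /qform mulmxN mulNmx mxE. Qed.

Lemma qform_gram_enorm (R : realType) (m n : nat) (A : 'M[R]_(m, n)) (z : 'cV[R]_n) :
  qform (A^T *m A) z = enorm (A *m z) ^+ 2.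
Proof. by rewrite enorm_sqr_ip /ip /mxtrace big_ord1 /qform trmx_mul !mulmxA. Qed.

(* If the supremum t of the Rayleigh quotients of A^T A were not an eigenvalue,  *)
(* t - A^T A would be positive definite, hence coercive, and t could be lowered. *)
Lemma enorm_mulmx_sigma_max (R : realType) (m n : nat) (A : 'M[R]_(m, n))
    (z : 'cV[R]_n) :
  enorm (A *m z) ^+ 2 <= sigma_max A ^+ 2 * enorm z ^+ 2.
Proof.
have [->|zn0] := eqVneq z 0; first by rewrite mulmx0 !enorm0 expr0n mulr0.
set S := [set u | exists2 v : 'cV[R]_n, v != 0 & u = enorm (A *m v) ^+ 2 / enorm v ^+ 2].
have Sub : ubound S (enorm A ^+ 2).
  move=> _ [v vn0 ->]; rewrite ler_pdivrMr ?enorm_sqr_gt0 //.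
  exact: enorm_mulmx_sqr.
have Ssup : has_sup S.
  by split; [exists (enorm (A *m z) ^+ 2 / enorm z ^+ 2), z|exists (enorm A ^+ 2)].
set t := sup S.
have tP (v : 'cV[R]_n) : enorm (A *m v) ^+ 2 <= t * enorm v ^+ 2.
  have [->|vn0] := eqVneq v 0; first by rewrite mulmx0 !enorm0 expr0n mulr0.
  rewrite -ler_pdivrMr ?enorm_sqr_gt0 //.
  by apply: sup_upper_bound => //; exists v.
have t_ge0 : 0 <= t.
  have := tP z; have := enorm_sqr_gt0 zn0; have := sqr_ge0 (enorm (A *m z)); nra.
have qB v : qform (t%:M - A^T *m A) v = t * enorm v ^+ 2 - enorm (A *m v) ^+ 2.
  by rewrite qformDmx qform_opp qform_scalar_mx qform_gram_enorm.
have eig_t : eigenvalue (A^T *m A) t.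
  apply: contrapT => neig.
  have Bpos : posdef (t%:M - A^T *m A).
    move=> v vn0; rewrite lt_neqAle eq_sym qB subr_ge0 tP andbT.
    (* A vector on which a semidefinite form vanishes lies in its kernel, by [psd_factor]; here it
       is an eigenvector for [t]. *)
    apply/negP => /eqP Bv0; apply: neig.
    have Bsym : symmetric_mx (t%:M - A^T *m A).
      by rewrite /symmetric_mx linearB /= tr_scalar_mx trmx_mul trmxK.
    have [|W WE] := psd_factor Bsym; first by move=> u; rewrite qB subr_ge0.
    have Wv : W *m v = 0.
      by apply: enorm_sqr_eq0; rewrite -qform_gram_enorm -WE qB.
    apply/eigenvalueP; exists v^T; last by rewrite trmx_eq0.
    have : (t%:M - A^T *m A) *m v = 0 by rewrite WE -mulmxA Wv mulmx0.
    rewrite mulmxBl mul_scalar_mx => /eqP; rewrite subr_eq0 => /eqP tv.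
    have -> : t *: v^T = (t *: v)^T by rewrite linearZ.
    by rewrite tv !trmx_mul trmxK.
  have [c c0 cP] := posdef_coercive Bpos.
  have : t <= t - c.
    apply: ge_sup; first by exists (enorm (A *m z) ^+ 2 / enorm z ^+ 2), z.
    move=> _ [v vn0 ->]; rewrite ler_pdivrMr ?enorm_sqr_gt0 //.
    have := cP _ v; rewrite mxtrace_qform big_ord1 col_id qB; lra.
  by lra.
(* An eigenvalue is the Rayleigh quotient of its eigenvector. This bounds the set of singular
   values, so that its [sup] is a genuine supremum. *)
have eigs_le s : eigenvalue (A^T *m A) s -> s <= t.
  move=> /eigenvalueP [v vE vn0].
  have v'n0 : v^T != 0 by rewrite trmx_eq0.
  have vE' : A^T *m A *m v^T = s *: v^T.
    by rewrite -[s *: _]trmxK [(s *: _)^T]linearZ /= trmxK -vE !trmx_mul trmxK.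
  have := tP v^T; rewrite -qform_gram_enorm /qform -mulmxA vE' -scalemxAr mxE.
  have -> : (v^T^T *m v^T) 0 0 = enorm v^T ^+ 2.
    by rewrite enorm_sqr_ip /ip /mxtrace big_ord1.
  by rewrite ler_pM2r ?enorm_sqr_gt0.
have : Num.sqrt t <= sigma_max A.
  apply: sup_upper_bound; last by split; rewrite ?sqrtr_ge0 ?sqr_sqrtr.
  split; first by exists (Num.sqrt t); split; rewrite ?sqrtr_ge0 ?sqr_sqrtr.
  exists (t + 1) => s [s0 /eigs_le]; nra.
move=> st; apply: le_trans (tP z) _; rewrite ler_pM2r ?enorm_sqr_gt0 //.
by rewrite -{1}(sqr_sqrtr t_ge0) ler_sqr ?nnegrE ?sqrtr_ge0 // (le_trans _ st) ?sqrtr_ge0.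
Qed.

Lemma enorm_mulmx_le (R : realType) (m n : nat) (A : 'M[R]_(m, n)) (L : R)
    (z : 'cV[R]_n) :
  0 <= L -> sigma_max A <= L -> enorm (A *m z) ^+ 2 <= L ^+ 2 * enorm z ^+ 2.
Proof.
move=> L0 AL; have [->|zn0] := eqVneq z 0.
  by rewrite mulmx0 !enorm0 expr0n mulr0.
apply: le_trans (enorm_mulmx_sigma_max A z) _; rewrite ler_pM2r ?enorm_sqr_gt0 //.
(* Comparing squares requires [sigma_max A] to be nonnegative, including where [sup] takes its
   default value 0. *)
rewrite ler_sqr // nnegrE /sigma_max; set S := [set _ | _].
have [->|/set0P[s Ss]] := eqVneq S set0; first by rewrite sup0.
have [Sub|nSub] := pselect (has_sup S).
  by apply: le_trans (sup_upper_bound Sub Ss); case: Ss.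
by rewrite sup_out.
Qed.

(** For [w = A^T *m z], the squared norm of [w] equals [ip z (A *m w)]; apply Cauchy-Schwarz and the
    bound for [A], then cancel a factor [enorm w ^+ 2]. *)
Lemma enorm_trmx_mulmx_le (R : realType) (m n : nat) (A : 'M[R]_(m, n)) (L : R)
    (z : 'cV[R]_m) :
  0 <= L -> sigma_max A <= L -> enorm (A^T *m z) ^+ 2 <= L ^+ 2 * enorm z ^+ 2.
Proof.
move=> L0 AL; set w := A^T *m z.
have [->|wn0] := eqVneq w 0.
  by rewrite enorm0 expr0n mulr_ge0 ?sqr_ge0.
have wp := enorm_sqr_gt0 wn0.
have CS := cauchy_schwarz z (A *m w).
have wE : ip z (A *m w) = enorm w ^+ 2.
  by rewrite enorm_sqr_ip /ip /w mulmxA trmx_mul trmxK.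
rewrite wE in CS; have := enorm_mulmx_le w L0 AL; move: CS wp.
move: (enorm w ^+ 2) (enorm (A *m w) ^+ 2) (enorm z ^+ 2) (sqr_ge0 (enorm z)) => a b c c0.
move=> ab a0 ba; rewrite -(ler_pM2r a0) -expr2; apply: le_trans ab _.
by apply: le_trans (ler_wpM2l c0 ba) _; rewrite mulrCA mulrA.
Qed.
(** * Interpolation inequality for smooth convex functions *)

(** The derivative is the limit of right difference quotients, each at most [c + t * K]; taking [t]
    below [e / (|K| + 1)] makes the error at most [e]. *)
Lemma derive_le_of_right (R : realType) (V : normedModType R) (f : V -> R)
    (x w : V) (c K : R) :
  derivable f x w ->
  (forall t, 0 < t -> t < 1 -> f (x + t *: w) - f x <= t * (c + t * K)) ->
  'D_w f x <= c.
Proof.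
move=> df fle; apply/ler_addgt0Pr => e e0.
rewrite /derive cvg_at_rightE //; apply: limr_le.
  rewrite -(cvg_at_rightE (fun h : R => h^-1 *: ((f \o shift x) (h *: w) - f x))) //.
  apply: cvg_trans df; apply: cvg_app => A [r r0 Ar].
  by exists r => // t tr t0; apply: Ar => //; exact: lt0r_neq0.
have K1 : 0 < `|K| + 1 by rewrite ltr_pwDr.
near=> t.
have t0 : 0 < t by near: t; exact: nbhs_right_gt.
have t1 : t < 1 by near: t; exact: nbhs_right_lt.
have tK : t < e / (`|K| + 1) by near: t; apply: nbhs_right_lt; rewrite divr_gt0.
rewrite /= [X in X <= _](_ : _ = (f (x + t *: w) - f x) / t); last first.
  by rewrite [RHS]mulrC [x + _]addrC.
rewrite ler_pdivrMr //.
apply: le_trans (fle t t0 t1) _; rewrite [leRHS]mulrC ler_pM2l // lerD2l.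
rewrite ltr_pdivlMr // in tK.
apply: le_trans (ltW tK); rewrite ler_pM2l //.
by have := ler_norm K; lra.
Unshelve. all: by end_near. Qed.

Section SmoothConvex.
Context (R : realType) (d : nat) (mu L : R) (p : 'cV[R]_d -> R).
Hypothesis pF : in_F mu L p.

Lemma derive_grad (x w : 'cV[R]_d) : 'D_w p x = ip (grad p x) w.
Proof.
have [pd _ _] := pF; rewrite deriveE // {1}[w]matrix_sum_delta.
under eq_bigr do rewrite big_ord1.
rewrite linear_sum ip_sum; apply: eq_bigr => i _.
by rewrite big_ord1 linearZ /= -deriveE // mxE mulrC.
Qed.

Lemma is_derive_line (x w : 'cV[R]_d) (t : R) :
  is_derive t 1 (fun s => p (x + s *: w)) (ip (grad p (x + t *: w)) w).
Proof.
have [pd _ _] := pF.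
have E : (fun h : R => h^-1 *: (((fun s => p (x + s *: w)) \o shift t) (h *: (1 : R))
      - p (x + t *: w))) =
    (fun h => h^-1 *: ((p \o shift (x + t *: w)) (h *: w) - p (x + t *: w))).
  apply/funext => h /=; congr (_ *: (p _ - _)).
  by rewrite [h *: _]mulr1 scalerDl addrCA.
rewrite -derive_grad; split; first by rewrite /derivable E; exact: diff_derivable.
by rewrite /derive E.
Qed.

(** Convexity of [p] minus its quadratic part on the segment from [v] to [u], divided by the step
    [t], bounds the difference quotient up to a term linear in [t]. *)
Lemma convex_lower_bound (u v : 'cV[R]_d) :
  p v + ip (grad p v) (u - v) + mu / 2 * enorm (u - v) ^+ 2 <= p u.
Proof.
have [pd pconv _] := pF; rewrite -[u](subrK v) addrK; move: (u - v) => {u} w.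
rewrite -derive_grad addrAC -lerBrDl.
apply: (derive_le_of_right (K := mu / 2 * enorm w ^+ 2)); first exact: diff_derivable.
move=> t t0 t1.
have t01 : Itv.spec (@Itv.num_sem R) (Itv.Real `[0%Z, 1%Z]) t.
  by rewrite /Itv.num_sem /= num_real in_itv /= !ltW.
have := pconv (Itv.mk t01) (w + v) v (in_setT _) (in_setT _).
rewrite convRE /=.
have -> : conv (Itv.mk t01) (w + v : convex_lmodType 'cV[R]_d) v = v + t *: w.
  rewrite /conv /= /unstable.onem scalerBl scale1r scalerDr.
  by rewrite addrA addrAC addrK addrC.
rewrite /unstable.onem !enorm_sqr_ip.
rewrite !ipE.
rewrite (ipC w v).
lra.
Qed.

(** [k] is [p] along the segment minus the claimed quadratic majorant without its constant term.
    Cauchy-Schwarz and the Lipschitz gradient make its derivative nonpositive, and the mean value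
    theorem concludes. *)
Lemma descent (u v : 'cV[R]_d) :
  p u <= p v + ip (grad p v) (u - v) + L / 2 * enorm (u - v) ^+ 2.
Proof.
have [pd _ plip] := pF; rewrite -[u](subrK v) addrK; move: (u - v) => {u} w.
pose k (t : R) := p (v + t *: w) - (t * ip (grad p v) w + t ^+ 2 * (L / 2 * enorm w ^+ 2)).
pose dk (t : R) := ip (grad p (v + t *: w)) w - (ip (grad p v) w + t * (L * enorm w ^+ 2)).
have kd (t : R) : is_derive t (1 : R) k (dk t).
  pose r : {poly R} := ip (grad p v) w *: 'X + (L / 2 * enorm w ^+ 2) *: 'X^2.
  have rE s : r.[s] = s * ip (grad p v) w + s ^+ 2 * (L / 2 * enorm w ^+ 2).
    by rewrite hornerD !hornerZ hornerX hornerXn; ring.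
  have -> : k = (fun s => p (v + s *: w)) - horner r.
    by apply/funext => s; rewrite -[RHS]/(p (v + s *: w) - r.[s]) rE.
  have -> : dk t = ip (grad p (v + t *: w)) w - r^`().[t].
    rewrite /dk derivD !derivZ derivX derivXn hornerD !hornerZ hornerMn hornerX.
    by rewrite -[1%R]/(1%:P) hornerC -mulr_natr; field.
  by apply: is_deriveB; exact: is_derive_line.
have kc : {within `[0, 1], continuous k}.
  apply: continuous_subspaceT => t; apply: differentiable_continuous.
  by apply/derivable1_diffP; case: (kd t).
have [c c01] := MVT ltr01 (fun x _ => kd x) kc.
have /andP[c0 _] : (0 < c) && (c < 1) by rewrite in_itv in c01.
have dkc : dk c <= 0.
  rewrite /dk opprD addrA -ipNl -ipDl subr_le0.
  apply: le_trans (ip_le _ _) _.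
  have := plip (v + c *: w) v; rewrite [v + _ - v]addrC addKr.
  have -> : enorm (c *: w) = c * enorm w.
    apply/eqP; rewrite -(@eqrXn2 _ 2) ?mulr_ge0 ?enorm_ge0 ?(ltW c0) // exprMn.
    by rewrite !enorm_sqr_ip !ipE mulrA expr2.
  move=> /(ler_wpM2r (enorm_ge0 w)) H; apply: le_trans H _.
  by rewrite expr2 le_eqVlt; apply/orP; left; apply/eqP; ring.
rewrite subr0 mulr1 /k !(scale0r, scale1r, addr0, mul0r, expr0n, expr1n, mul1r, subr0) /=.
rewrite (addrC w v).
lra.
Qed.

(* Compare the two bounds on [p] at the gradient step from [u]; the step length *)
(* is kept free so that the degenerate case [mu = L] is covered as well.        *)
Lemma smooth_convex_interpolation (u v : 'cV[R]_d) : mu <= L ->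
  0 <= (L - mu) * (p u - p v) + 2^-1 *
    (- (mu * L) * enorm (u - v) ^+ 2 + 2 * mu * ip (grad p u) (u - v)
     - 2 * L * ip (grad p v) (u - v) - enorm (grad p u - grad p v) ^+ 2).
Proof.
move=> muL; set gu := grad p u; set gv := grad p v.
(* For [phi = p - mu / 2 * enorm _ ^+ 2], [dphi] is the difference of gradients and [D] the Bregman
   divergence of [phi] between [u] and [v]. *)
pose dphi := (gu - gv) - mu *: (u - v).
pose D := p u - p v - mu / 2 * enorm (u - v) ^+ 2 - ip gv (u - v).
pose s := enorm dphi ^+ 2.
have step t : t * s - (L - mu) / 2 * t ^+ 2 * s <= D.
  have := convex_lower_bound (u - t *: dphi) v.
  have := descent (u - t *: dphi) u.
  rewrite -/gu -/gv.
  have -> : u - t *: dphi - u = - t *: dphi by rewrite addrAC subrr add0r scaleNr.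
  have -> : u - t *: dphi - v = (u - v) - t *: dphi by rewrite addrAC.
  have guE : gu = dphi + gv + mu *: (u - v).
    by rewrite /dphi addrAC subrK subrK.
  rewrite /D /s guE; clear s guE; move: (u - v) dphi => w z.
  rewrite !enorm_sqr_ip !ipE (ipC w z); nra.
have sE : s = enorm (gu - gv) ^+ 2 - 2 * mu * (ip gu (u - v) - ip gv (u - v))
            + mu ^+ 2 * enorm (u - v) ^+ 2.
  rewrite /s /dphi; move: (u - v) => w; rewrite !enorm_sqr_ip !ipE !(ipC w); ring.
suff sD : s / 2 <= (L - mu) * D.
  by move: sD; rewrite sE /D; lra.
(* If [mu = L], the quadratic term of [step] vanishes and arbitrary [t] forces [s = 0]. Otherwise
   [t = (L - mu)^-1] is the best step. *)
have [mL|Lmu] := eqVneq mu L.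
  have := linear_term_eq0 (b := - s) (d := D).
  rewrite mL in step *; move=> H.
  have s0 : - s = 0 by apply: H => t; have := step t; lra.
  by lra.
have l0 : 0 < L - mu by rewrite subr_gt0 lt_neqAle Lmu.
have := step (L - mu)^-1; rewrite -(ler_pM2l l0); apply: le_trans.
by rewrite le_eqVlt; apply/orP; left; apply/eqP; field; rewrite gt_eqF.
Qed.

End SmoothConvex.
(** * Matrices as coefficients of quadratic forms on stacked vectors *)

Definition trq (R : realType) (n d : nat) (Z : 'M[R]_n) (X : 'M[R]_(n, d)) : R :=
  \tr (X^T *m Z *m X).

Lemma big_mxtens (R : realType) (n d : nat) (F : 'I_(n * d) -> R) :
  \sum_i F i = \sum_r \sum_c F (mxtens_index (r, c)).
Proof.
rewrite pair_bigA (reindex (@mxtens_index n d)) /=.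
  by apply: eq_bigr => -[].
by exists (@mxtens_unindex n d) => i _; rewrite (mxtens_indexK, mxtens_unindexK).
Qed.

Section TraceForm.
Context (R : realType) (n d : nat).
Implicit Types (Z : 'M[R]_n) (X : 'M[R]_(n, d)).

Lemma trqD Z Z' X : trq (Z + Z') X = trq Z X + trq Z' X.
Proof. by rewrite /trq mulmxDr mulmxDl mxtraceD. Qed.

Lemma trqN Z X : trq (- Z) X = - trq Z X.
Proof. by rewrite /trq mulmxN mulNmx raddfN. Qed.

Lemma trqZ t Z X : trq (t *: Z) X = t * trq Z X.
Proof. by rewrite /trq -scalemxAr -scalemxAl mxtraceZ. Qed.

Lemma trq_sum (I : finType) (f : I -> 'M[R]_n) X :
  trq (\sum_i f i) X = \sum_i trq (f i) X.
Proof. by rewrite /trq mulmx_sumr mulmx_suml raddf_sum. Qed.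

Lemma trq_mul m (B C : 'M[R]_(n, m)) (D : 'M[R]_m) X :
  trq (B *m D *m C^T) X = \tr ((B^T *m X)^T *m D *m (C^T *m X)).
Proof. by rewrite /trq trmx_mul trmxK !mulmxA. Qed.

Lemma trq_congr m (S : 'M[R]_(m, n)) (D : 'M[R]_m) X :
  trq (S^T *m D *m S) X = trq D (S *m X).
Proof. by rewrite /trq trmx_mul !mulmxA. Qed.

Lemma trq_le0 Z X : negsemidef Z -> trq Z X <= 0.
Proof. by move=> Zneg; rewrite /trq mxtrace_qform sumr_le0. Qed.

Lemma trq_ip_row Z X : trq Z X = \sum_r \sum_c Z r c * ip (row r X) (row c X).
Proof.
rewrite /trq -mulmxA -/(ip _ _) ip_sum; apply: eq_bigr => r _.
under eq_bigr do rewrite mxE mulr_sumr.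
rewrite exchange_big; apply: eq_bigr => c _.
rewrite ip_sum big_ord1 mulr_sumr; apply: eq_bigr => j _.
by rewrite !mxE mulrCA.
Qed.

Lemma qform_tens_stack Z X :
  qform (tensmx Z (1%:M : 'M[R]_d)) (stack X) = trq Z X.
Proof.
have E (M : 'M[R]_(n * d)) (v : 'cV[R]_(n * d)) :
    qform M v = \sum_i \sum_j v i 0 * M i j * v j 0.
  rewrite /qform mxE exchange_big; apply: eq_bigr => j _.
  by rewrite mxE mulr_suml; apply: eq_bigr => i _; rewrite mxE.
rewrite E trq_ip_row.
rewrite big_mxtens; apply: eq_bigr => r _.
transitivity (\sum_i \sum_c X r i * Z r c * X c i); last first.
  rewrite exchange_big; apply: eq_bigr => c _.
  rewrite ip_sum big_ord1 mulr_sumr; apply: eq_bigr => j _.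
  by rewrite !mxE mulrCA mulrA.
apply: eq_bigr => i _; rewrite big_mxtens.
apply: eq_bigr => c _; rewrite (bigD1 i) //= big1 => [|j ji].
  by rewrite tensmxE !mxE !mxtens_indexK /= eqxx mulr1 addr0.
by rewrite tensmxE [1%:M _ _]mxE eq_sym (negbTE ji) !(mulr0, mul0r).
Qed.

End TraceForm.

(** Matrix form of the adjunction between [A] and [A^T], by cyclicity of the trace. *)
Lemma coupling_cancel (R : realType) (m dx dy : nat) (A : 'M[R]_(dy, dx))
    (C : 'M[R]_m) (Vx : 'M[R]_(m, dx)) (Vy : 'M[R]_(m, dy)) :
  \tr ((Vx *m A^T)^T *m C *m Vy) = \tr (Vx^T *m C *m (Vy *m A)).
Proof. by rewrite trmx_mul trmxK -!mulmxA mxtrace_mulC !mulmxA. Qed.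

(** The gap between the two sides is the pairing of [C] with the semidefinite matrix
    [L ^+ 2 - A *m A^T]. *)
Lemma coupling_le (R : realType) (m dx dy : nat) (A : 'M[R]_(dy, dx)) (L : R)
    (C : 'M[R]_m) (V : 'M[R]_(m, dy)) :
  symmetric_mx C -> possemidef C ->
  (forall z : 'cV[R]_dy, enorm (A^T *m z) ^+ 2 <= L ^+ 2 * enorm z ^+ 2) ->
  trq C (V *m A) <= L ^+ 2 * trq C V.
Proof.
move=> Csym Cpsd AL.
have Qpsd : possemidef ((L ^+ 2)%:M - A *m A^T).
  move=> z; rewrite qformDmx qform_opp qform_scalar_mx -{1}[A]trmxK qform_gram_enorm.
  by rewrite subr_ge0.
have := psd_pairing_ge0 V Csym Cpsd Qpsd.
rewrite mulmxBr mul_mx_scalar raddfB /= mxtraceZ subr_ge0.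
suff -> : trq C (V *m A) = \tr (V^T *m C *m V *m (A *m A^T)) by [].
by rewrite /trq trmx_mul -!mulmxA mxtrace_mulC !mulmxA.
Qed.

Lemma ip_trmx (R : realType) (m n : nat) (X Y : 'M[R]_(m, n)) :
  ip X^T Y^T = ip X Y.
Proof.
rewrite !ip_sum exchange_big; apply: eq_bigr => i _.
by apply: eq_bigr => j _; rewrite !mxE.
Qed.

Section Comb.
Context (R : realType).

Lemma eq_comb (V : lmodType R) (n : nat) (c : 'I_n -> R) (s t : int -> V) (k l : int) :
  (forall j : 'I_n, s (k - j%:Z) = t (l - j%:Z)) -> comb c s k = comb c t l.
Proof. by move=> st; apply: eq_bigr => j _; rewrite st. Qed.

Lemma comb_mulmx (n m d : nat) (c : 'I_n -> R) (s : int -> 'rV[R]_m)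
    (X : 'M[R]_(m, d)) (k : int) :
  comb c s k *m X = comb c (fun i => s i *m X) k.
Proof. by rewrite /comb mulmx_suml; apply: eq_bigr => j _; rewrite scalemxAl. Qed.

Lemma comb_trmx (n d : nat) (c : 'I_n -> R) (s : int -> 'cV[R]_d) (k : int) :
  (comb c s k)^T = comb c (fun i => (s i)^T) k.
Proof. by rewrite /comb linear_sum; apply: eq_bigr => j _; rewrite linearZ. Qed.

Lemma unit_row_mul (n d i : nat) (lt_in : (i < n)%N) (X : 'M[R]_(n, d)) :
  unit_row R n i *m X = row (Ordinal lt_in) X.
Proof.
rewrite rowE; congr (_ *m _); apply/rowP => j.
by rewrite !mxE eqxx -val_eqE.
Qed.

End Comb.

(** * Barred vectors evaluated on a trajectory *)

Section Lift.
Context (R : realType) (N K d s : nat) (X G H : int -> 'cV[R]_d).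

(* The bar system started at time [s]: multiplying a barred row vector by       *)
(* [lift_mx] gives the vector it stands for, shifted by [s].                    *)
Definition lift_mx : 'M[R]_(bar_dim N K, d) :=
  \matrix_(i < bar_dim N K)
    (if (i <= N)%N then X (s%:Z + i%:Z - N%:Z)
     else if (i <= N + K + 1)%N then G (s + (i - N.+1))%N%:Z
     else H (s + (i - (N + K + 2)))%N%:Z)^T.

Lemma init_bar_lift (j : int) : - N%:Z <= j -> j <= 0 ->
  init_bar R N K j *m lift_mx = (X (j + s%:Z))^T.
Proof.
move=> jN j0; have jE : (absz (j + N%:Z))%:Z = j + N%:Z by lia.
have lt : (absz (j + N%:Z)%R < bar_dim N K)%N by rewrite /bar_dim; lia.
rewrite /init_bar (unit_row_mul lt) rowK /=.
have -> : (absz (j + N%:Z)%R <= N)%N by lia.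
by congr (X _)^T; lia.
Qed.

Lemma g_bar_lift (j : nat) : (j <= K)%N ->
  g_bar R N K j%:Z *m lift_mx = (G (s + j)%N%:Z)^T.
Proof.
move=> jK; have lt : (j + N + 1 < bar_dim N K)%N by rewrite /bar_dim; lia.
rewrite /g_bar (unit_row_mul lt) rowK /=.
have -> : (j + N + 1 <= N)%N = false by lia.
have -> : (j + N + 1 <= N + K + 1)%N by lia.
by congr (G _)^T; lia.
Qed.

Lemma h_bar_lift (j : nat) : (j <= K)%N ->
  h_bar R N K j%:Z *m lift_mx = (H (s + j)%N%:Z)^T.
Proof.
move=> jK; have lt : (j + K + N + 2 < bar_dim N K)%N by rewrite /bar_dim; lia.
rewrite /h_bar (unit_row_mul lt) rowK /=.
have -> : (j + K + N + 2 <= N)%N = false by lia.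
have -> : (j + K + N + 2 <= N + K + 1)%N = false by lia.
by congr (H _)^T; lia.
Qed.

Lemma lin_rec_lift (c : 'I_N.+1 -> R) (w : int -> 'rV[R]_(bar_dim N K)) :
  (forall k : nat, (k <= K)%N ->
     w k%:Z *m lift_mx
     = (X ((s + k)%N%:Z + 1) - comb c X (s + k)%N%:Z)^T) ->
  forall j : int, - N%:Z <= j -> j <= K%:Z + 1 ->
  lin_rec c (init_bar R N K) w j *m lift_mx = (X (j + s%:Z))^T.
Proof.
move=> wE; set r := lin_rec _ _ _.
(* Induction on the upper end of the range: for [k >= 0] the recursion reads only the indices from
   [k - N] to [k], all at least [- N]. *)
suff H1 (k : nat) : (k <= K.+1)%N -> forall j : int, - N%:Z <= j -> j <= k%:Z ->
    r j *m lift_mx = (X (j + s%:Z))^T.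
  by move=> j jN jK; apply: (H1 K.+1) => //; lia.
elim: k => [_|k IHk kK] j jN jk; first by rewrite /r lin_rec0 // init_bar_lift.
have [jk'|jk'] := leP j k%:Z; first by apply: IHk => //; lia.
have -> : j = k%:Z + 1 by lia.
rewrite /r lin_recS -/r mulmxDl wE; last by lia.
rewrite linearB /= comb_trmx comb_mulmx.
have -> : comb c (fun i => r i *m lift_mx) k%:Z
          = comb c (fun i => (X i)^T) (s + k)%N%:Z.
  apply: eq_comb => i; rewrite IHk; [congr (X _)^T; lia|lia| |lia].
  by have := ltn_ord i; lia.
by rewrite addrC subrK; congr (X _)^T; lia.
Qed.

(** The bound on [n] keeps the oldest index read, [k - n + 1], at or above [- N]. Allowing [k] up to
    [K + 1] covers [vx_bar], which reads one iterate ahead. *)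
Lemma comb_lift (r : int -> 'rV[R]_(bar_dim N K)) (n : nat) (c : 'I_n -> R) (k : int) :
  (forall j : int, - N%:Z <= j -> j <= K%:Z + 1 -> r j *m lift_mx = (X (j + s%:Z))^T) ->
  n%:Z <= k + N%:Z + 1 -> k <= K%:Z + 1 ->
  comb c r k *m lift_mx = (comb c X (k + s%:Z))^T.
Proof.
move=> rE nk kK; rewrite comb_mulmx comb_trmx; apply: eq_comb => j.
by have := ltn_ord j => jn; rewrite rE; [congr (X _)^T; lia|lia|lia].
Qed.

Lemma window_lift (r : int -> 'rV[R]_(bar_dim N K)) (Y : int -> 'cV[R]_d) (k l : int) :
  (forall i : nat, (i <= N)%N -> r (k - i%:Z) *m lift_mx = (Y (l - i%:Z))^T) ->
  window N r k *m lift_mx = window N (fun i => (Y i)^T) l.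
Proof.
move=> rE; apply/row_matrixP => i; rewrite row_mul !rowK rE //.
by rewrite -ltnS.
Qed.

(** [N <= k] because the windows of [g_bar] and [h_bar] reach back to [k - N], and these vectors
    exist only from index 0. *)
Lemma V_bar_lift (P : 'M[R]_(lyap_dim N)) (r : int -> 'rV[R]_(bar_dim N K)) (k : nat) :
  (forall j : int, - N%:Z <= j -> j <= K%:Z + 1 -> r j *m lift_mx = (X (j + s%:Z))^T) ->
  (N <= k <= K)%N ->
  trq (V_bar P r k%:Z) lift_mx
  = trq P (stack3 (window N (fun i => (X i)^T) (s + k)%N%:Z)
                  (window N (fun i => (G i)^T) (s + k)%N%:Z)
                  (window N (fun i => (H i)^T) (s + k)%N%:Z)).
Proof.
move=> rE /andP[Nk kK]; rewrite /V_bar trq_congr /stack3 !mul_col_mx.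
congr (trq _ (col_mx (col_mx _ _) _)); apply: window_lift => i iN.
- by rewrite rE; [congr (X _)^T; lia|lia|lia].
- have -> : k%:Z - i%:Z = (k - i)%N%:Z by lia.
  by rewrite g_bar_lift; [congr (G _)^T; lia|lia].
- have -> : k%:Z - i%:Z = (k - i)%N%:Z by lia.
  by rewrite h_bar_lift; [congr (H _)^T; lia|lia].
Qed.

Lemma B_mx_lift (r : int -> 'rV[R]_(bar_dim N K)) (Y : int -> 'cV[R]_d) :
  (forall k : nat, (k <= K)%N -> r k%:Z *m lift_mx = (Y (s + k)%N%:Z)^T) ->
  (B_mx r)^T *m lift_mx = \matrix_(k < K.+1) (Y (s + k)%N%:Z)^T.
Proof.
move=> rE; rewrite /B_mx trmxK; apply/row_matrixP => i.
by rewrite row_mul !rowK rE // -ltnS.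
Qed.

(** Expanding the sixteen entries of [M_mx] yields exactly the quadratic part of
    [smooth_convex_interpolation]. *)
Lemma interp_M_lift (mu L : R) (u : int -> 'rV[R]_(bar_dim N K)) (i j : idx K)
    (ui uj gi gj : 'cV[R]_d) :
  at_idx u i *m lift_mx = ui^T -> at_idx u j *m lift_mx = uj^T ->
  at_idx (g_bar R N K) i *m lift_mx = gi^T ->
  at_idx (g_bar R N K) j *m lift_mx = gj^T ->
  trq (interp_M mu L u i j) lift_mx = 2^-1 *
    (- (mu * L) * enorm (ui - uj) ^+ 2 + 2 * mu * ip gi (ui - uj)
     - 2 * L * ip gj (ui - uj) - enorm (gi - gj) ^+ 2).
Proof.
move=> uiE ujE giE gjE; rewrite /interp_M; set S := (\matrix_r _).
rewrite trq_congr.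
have rowS : S *m lift_mx = \matrix_(r < 4) (nth 0 [:: ui; uj; gi; gj] r)^T.
  apply/row_matrixP => r; rewrite row_mul !rowK.
  by case: r => -[|[|[|[|//]]]] /= _.
rewrite rowS trq_ip_row.
rewrite !big_ord_recl !big_ord0 !rowK !mxE /= !ip_trmx !enorm_sqr_ip !ipE.
rewrite !(ipC uj ui) !(ipC gi ui) !(ipC gj ui) !(ipC gi uj) !(ipC gj uj) !(ipC gj gi).
ring.
Qed.
End Lift.

(** * One half of the system, used for both the [x] and the [y] variables *)

Section HalfSystem.
Context (R : realType) (N K d s : nat) (mu L : R) (p : 'cV[R]_d -> R).
Context (X U H : int -> 'cV[R]_d).
Context (xb ub : int -> 'rV[R]_(bar_dim N K)).
Let G k := grad p (U k).
Let Xi := lift_mx N K s X G H.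
Definition fvals : 'cV[R]_K.+1 := \col_(j < K.+1) p (U (s + j)%N%:Z).

Lemma fvals_window (k : nat) : (N <= k <= K)%N ->
  window N (f_bar R K) k%:Z *m fvals
  = \col_(j < N.+1) p (U ((s + k)%N%:Z - j%:Z)).
Proof.
move=> /andP[Nk kK]; apply/row_matrixP => i; rewrite row_mul rowK.
have iN : (i <= N)%N by rewrite -ltnS.
have lt : (absz (k%:Z - i%:Z)%R < K.+1)%N by lia.
rewrite /f_bar (unit_row_mul lt); apply/rowP => j; rewrite !mxE /=.
by congr (p (U _)); lia.
Qed.

Definition half_lyapunov (P : 'M[R]_(lyap_dim N)) (w : 'cV[R]_N.+1) (k : int) : R :=
  trq P (stack3 (window N (fun i => (X i)^T) k) (window N (fun i => (G i)^T) k)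
                (window N (fun i => (H i)^T) k))
  + ip w (\col_(j < N.+1) p (U (k - j%:Z))).

Hypothesis xb_lift : forall j : int,
  - N%:Z <= j -> j <= K%:Z + 1 -> xb j *m Xi = (X (j + s%:Z))^T.
Lemma half_lyapunov_lift P w (k : nat) : (N <= k <= K)%N ->
  trq (V_bar P xb k%:Z) Xi + ip (v_bar K w k%:Z) fvals
  = half_lyapunov P w (s + k)%N%:Z.
Proof.
move=> kNK; rewrite (V_bar_lift P xb_lift) // /half_lyapunov -fvals_window //.
by rewrite /v_bar /ip trmx_mul trmxK mulmxA.
Qed.

Hypotheses (pF : in_F mu L p) (mu_ge0 : 0 <= mu).
Hypotheses (grad0 : grad p 0 = 0) (p0 : p 0 = 0).

(** The lower bound at the origin, where [p] and its gradient vanish, shows that 0 minimizes [p]. *)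
Lemma fvals_ge0 j : 0 <= fvals j 0.
Proof.
rewrite mxE; set u := U _.
have := convex_lower_bound pF u 0; rewrite p0 grad0 /ip linear0 mul0mx mxtrace0.
have : 0 <= mu / 2 * enorm (u - 0) ^+ 2.
  by rewrite mulr_ge0 ?sqr_ge0 ?divr_ge0.
by lra.
Qed.

(* The states are images of [Xi] and [fvals] under matrices that do not depend *)
(* on the functions, the dimensions or the iteration.                          *)
Lemma half_state_le (k : nat) : (N <= k <= K)%N ->
  enorm (window N (fun i => (X i)^T) (s + k)%N%:Z) ^+ 2
  + enorm (window N (fun i => (G i)^T) (s + k)%N%:Z) ^+ 2
  + enorm (window N (fun i => (H i)^T) (s + k)%N%:Z) ^+ 2
  + enorm (\col_(j < N.+1) p (U ((s + k)%N%:Z - j%:Z))) ^+ 2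
  <= (enorm (window N xb k%:Z) ^+ 2 + enorm (window N (g_bar R N K) k%:Z) ^+ 2
      + enorm (window N (h_bar R N K) k%:Z) ^+ 2) * enorm Xi ^+ 2
     + enorm (window N (f_bar R K) k%:Z) ^+ 2 * (\sum_j fvals j 0) ^+ 2.
Proof.
move=> kNK; have /andP[Nk kK] := kNK.
rewrite -fvals_window // !mulrDl; repeat apply: lerD.
- rewrite -(@window_lift _ _ _ _ s X G H xb X k%:Z); first exact: enorm_mulmx_sqr.
  by move=> i iN; rewrite xb_lift; [congr (X _)^T; lia|lia|lia].
- rewrite -(@window_lift _ _ _ _ s X G H (g_bar R N K) G k%:Z).
    exact: enorm_mulmx_sqr.
  move=> i iN; have -> : k%:Z - i%:Z = (k - i)%N%:Z by lia.
  by rewrite g_bar_lift; [congr (G _)^T; lia|lia].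
- rewrite -(@window_lift _ _ _ _ s X G H (h_bar R N K) H k%:Z).
    exact: enorm_mulmx_sqr.
  move=> i iN; have -> : k%:Z - i%:Z = (k - i)%N%:Z by lia.
  by rewrite h_bar_lift; [congr (H _)^T; lia|lia].
apply: le_trans (enorm_mulmx_sqr _ _) _; rewrite ler_wpM2l ?sqr_ge0 //.
have S_ge0 : 0 <= \sum_j fvals j 0 by apply: sumr_ge0 => j _; exact: fvals_ge0.
(* For nonnegative numbers the sum of squares is at most the square of the sum. *)
rewrite enorm_sqr expr2 mulr_suml; apply: ler_sum => j _; rewrite big_ord1 expr2.
rewrite ler_wpM2l ?fvals_ge0 // (bigD1 j) //= lerDl.
by apply: sumr_ge0 => i _; exact: fvals_ge0.
Qed.

Hypothesis muL : mu <= L.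
Hypothesis ub_lift : forall j : nat,
  (j <= K)%N -> ub j%:Z *m Xi = (U (s + j)%N%:Z)^T.

Let u_at (i : idx K) : 'cV[R]_d := if i is Some k then U (s + k)%N%:Z else 0.

(** The index [None] stands for the saddle point: its barred vectors are zero, matching the zero
    point, gradient and value there, so every pair is an instance of the interpolation
    inequality. *)
Lemma interp_ge0 (i j : idx K) :
  0 <= trq (interp_M mu L ub i j) Xi + ip (interp_m mu L i j) fvals.
Proof.
have ubE k : at_idx ub k *m Xi = (u_at k)^T.
  by case: k => [k|] /=; rewrite ?linear0 ?mul0mx // ub_lift // -ltnS.
have gbE k : at_idx (g_bar R N K) k *m Xi = (grad p (u_at k))^T.
  case: k => [k|] /=; last by rewrite grad0 linear0 mul0mx.
  by rewrite g_bar_lift // -ltnS.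
have fbE k : ip (at_idx (f_bar R K) k)^T fvals = p (u_at k).
  rewrite /ip trmxK /mxtrace big_ord1; case: k => [k|] /=.
    by rewrite /f_bar (unit_row_mul (ltn_ord k)) !mxE.
  by rewrite mul0mx mxE p0.
rewrite (interp_M_lift _ _ (ubE i) (ubE j) (gbE i) (gbE j)).
rewrite /interp_m linearB /= [ip _ fvals]ipZl ipDl ipNl !fbE addrC.
exact: smooth_convex_interpolation pF _ _ muL.
Qed.

Lemma interp_sum_ge0 (w : idx K -> idx K -> R) : (forall i j, 0 <= w i j) ->
  0 <= trq (\sum_i \sum_j w i j *: interp_M mu L ub i j) Xi
       + ip (\sum_i \sum_j w i j *: interp_m mu L i j) fvals.
Proof.
move=> w_ge0; rewrite trq_sum ipC /ip mulmx_sumr raddf_sum -big_split.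
apply: sumr_ge0 => i _; rewrite /= trq_sum mulmx_sumr raddf_sum -big_split.
apply: sumr_ge0 => j _ /=; rewrite trqZ -/(ip _ _) ipZr ipC -mulrDr.
by rewrite mulr_ge0 // interp_ge0.
Qed.

End HalfSystem.

(** * Both halves along a trajectory, coupled through [A] *)

Section Run.
Context (R : realType) (N K dx dy s : nat) (mux muy Lx Ly Lxy : R) (a : method R N).
Context (p : 'cV[R]_dx -> R) (q : 'cV[R]_dy -> R) (A : 'M[R]_(dy, dx)).
Context (x : int -> 'cV[R]_dx) (y : int -> 'cV[R]_dy).
Hypotheses (mux_ge0 : 0 <= mux) (muLx : mux <= Lx).
Hypotheses (muy_ge0 : 0 <= muy) (muLy : muy <= Ly) (Lxy_ge0 : 0 <= Lxy).
Hypotheses (fK : in_K mux muy Lx Ly Lxy p q A) (fN : normalized p q A).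
Hypothesis run : is_run a p q A x y.

Let XiX := lift_mx N K s x (gx a p x) (hx a A y).
Let XiY := lift_mx N K s y (gy a q y) (hy a A x).

Lemma x_bar_lift (j : int) : - N%:Z <= j -> j <= K%:Z + 1 ->
  x_bar a K j *m XiX = (x (j + s%:Z))^T.
Proof.
apply: lin_rec_lift => k kK; have [-> _] := run (s + k).
rewrite mulmxBl mulNmx -!scalemxAl g_bar_lift // h_bar_lift //.
by rewrite addrAC [_ - comb _ _ _]addrAC subrr sub0r !linearB /= linearN /= !linearZ.
Qed.

Lemma y_bar_lift (j : int) : - N%:Z <= j -> j <= K%:Z + 1 ->
  y_bar a K j *m XiY = (y (j + s%:Z))^T.
Proof.
apply: lin_rec_lift => k kK; have [_ ->] := run (s + k).
rewrite mulmxDl mulNmx -!scalemxAl g_bar_lift // h_bar_lift //.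
by rewrite addrAC [_ - comb _ _ _]addrAC subrr sub0r !linearD /= linearN /= !linearZ.
Qed.

Lemma ux_bar_lift (j : nat) : (j <= K)%N ->
  ux_bar a K j%:Z *m XiX = (ux a x (s + j)%N%:Z)^T.
Proof.
move=> jK; rewrite /ux_bar (comb_lift _ x_bar_lift); [|lia|lia].
by rewrite /ux addrC PoszD.
Qed.

Lemma uy_bar_lift (j : nat) : (j <= K)%N ->
  uy_bar a K j%:Z *m XiY = (uy a y (s + j)%N%:Z)^T.
Proof.
move=> jK; rewrite /uy_bar (comb_lift _ y_bar_lift); [|lia|lia].
by rewrite /uy addrC PoszD.
Qed.

Lemma vx_bar_lift (j : nat) : (j <= K)%N ->
  vx_bar a K j%:Z *m XiX = (vx a x (s + j)%N%:Z)^T.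
Proof.
move=> jK; rewrite /vx_bar (comb_lift _ x_bar_lift); [|lia|lia].
by rewrite /vx addrAC [j%:Z + _]addrC PoszD.
Qed.

Lemma vy_bar_lift (j : nat) : (j <= K)%N ->
  vy_bar a K j%:Z *m XiY = (vy a y (s + j)%N%:Z)^T.
Proof.
move=> jK; rewrite /vy_bar (comb_lift _ y_bar_lift); [|lia|lia].
by rewrite /vy addrC PoszD.
Qed.

Lemma coupling_sum_le0 (C1 C2 C3 : 'M[R]_K.+1) :
  symmetric_mx C2 -> symmetric_mx C3 -> possemidef C2 -> possemidef C3 ->
  trq (B_vx a K *m C1 *m (B_H R N K)^T) XiX
  + trq (B_H R N K *m C2 *m (B_H R N K)^T) XiX
  - Lxy ^+ 2 * trq (B_vx a K *m C3 *m (B_vx a K)^T) XiX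
  - trq (B_H R N K *m C1 *m (B_vy a K)^T) XiY
  - Lxy ^+ 2 * trq (B_vy a K *m C2 *m (B_vy a K)^T) XiY
  + trq (B_H R N K *m C3 *m (B_H R N K)^T) XiY <= 0.
Proof.
move=> C2sym C3sym C2psd C3psd; have [_ _ AL] := fK.
have VxE := B_mx_lift (Y := vx a x) vx_bar_lift.
have VyE := B_mx_lift (Y := vy a y) vy_bar_lift.
(* The [h] rows are [A] applied to the [v] rows of the other half. This is the only link between the
   two halves. *)
have HxE : (B_H R N K)^T *m XiX = (B_vy a K)^T *m XiY *m A.
  rewrite VyE (B_mx_lift (Y := hx a A y)); last exact: h_bar_lift.
  by apply/row_matrixP => i; rewrite row_mul !rowK trmx_mul trmxK.
have HyE : (B_H R N K)^T *m XiY = (B_vx a K)^T *m XiX *m A^T.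
  rewrite VxE (B_mx_lift (Y := hy a A x)); last exact: h_bar_lift.
  by apply/row_matrixP => i; rewrite row_mul !rowK trmx_mul.
rewrite !trq_mul HxE HyE coupling_cancel -!/(trq _ _).
have := @coupling_le _ _ _ _ A Lxy C2 ((B_vy a K)^T *m XiY) C2sym C2psd
  (fun z => enorm_trmx_mulmx_le z Lxy_ge0 AL).
have := @coupling_le _ _ _ _ A^T Lxy C3 ((B_vx a K)^T *m XiX) C3sym C3psd.
rewrite trmxK => /(_ (fun z => enorm_mulmx_le z Lxy_ge0 AL)).
by lra.
Qed.

Lemma lyapunov_state_at (Px Py : 'M[R]_(lyap_dim N)) (px py : 'cV[R]_N.+1) (k : nat) :
  lyapunov Px Py px py (state_at a p q A x y k)
  = half_lyapunov p x (ux a x) (hx a A y) Px px k%:Z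
    + half_lyapunov q y (uy a y) (hy a A x) Py py k%:Z.
Proof.
rewrite /lyapunov !qform_tens_stack /half_lyapunov /ip /mxtrace !big_ord1 /=.
by rewrite -addrA addrACA.
Qed.

Let FX := fvals K s p (ux a x).
Let FY := fvals K s q (uy a y).

(** The left side is the Lyapunov function minus the nonnegative interpolation sums plus the
    nonpositive coupling sum. *)
Lemma positivity_lower_bound (Px Py : 'M[R]_(lyap_dim N)) (px py : 'cV[R]_N.+1)
    (C1 C2 C3 : 'M[R]_K.+1) (lam lamb : idx K -> idx K -> R) : (N <= K)%N ->
  symmetric_mx C2 -> symmetric_mx C3 -> possemidef C2 -> possemidef C3 ->
  (forall i j, 0 <= lam i j /\ 0 <= lamb i j) ->
  trq (V_bar Px (x_bar a K) N%:Z
        - \sum_i \sum_j lam i j *: interp_M mux Lx (ux_bar a K) i j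
        + B_vx a K *m C1 *m (B_H R N K)^T + B_H R N K *m C2 *m (B_H R N K)^T
        - Lxy ^+ 2 *: (B_vx a K *m C3 *m (B_vx a K)^T)) XiX
  + trq (V_bar Py (y_bar a K) N%:Z
        - \sum_i \sum_j lamb i j *: interp_M muy Ly (uy_bar a K) i j
        - B_H R N K *m C1 *m (B_vy a K)^T
        - Lxy ^+ 2 *: (B_vy a K *m C2 *m (B_vy a K)^T)
        + B_H R N K *m C3 *m (B_H R N K)^T) XiY
  + ip (v_bar K px N%:Z - \sum_i \sum_j lam i j *: interp_m mux Lx i j) FX
  + ip (v_bar K py N%:Z - \sum_i \sum_j lamb i j *: interp_m muy Ly i j) FY
  <= lyapunov Px Py px py (state_at a p q A x y (s + N)).
Proof.
move=> leNK C2sym C3sym C2psd C3psd lam_ge0.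
have [pF qF _] := fK; have [_ gp0 gq0 p0 q0] := fN.
have NK : (N <= N <= K)%N by rewrite leqnn.
have lamX := interp_sum_ge0 (X := x) (U := ux a x) (H := hx a A y) pF gp0 p0 muLx
  ux_bar_lift (fun i j => proj1 (lam_ge0 i j)).
have lamY := interp_sum_ge0 (X := y) (U := uy a y) (H := hy a A x) qF gq0 q0 muLy
  uy_bar_lift (fun i j => proj2 (lam_ge0 i j)).
have := coupling_sum_le0 C1 C2sym C3sym C2psd C3psd.
rewrite lyapunov_state_at -(half_lyapunov_lift (U := ux a x) x_bar_lift Px px NK).
rewrite -(half_lyapunov_lift (U := uy a y) y_bar_lift Py py NK).
rewrite !ipDl !ipNl !trqD !trqN !trqZ.
move: lamX lamY; rewrite -/XiX -/XiY -/FX -/FY.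
by lra.
Qed.

(** Here the multiplier terms have the opposite sign, giving an upper bound. [N < K] makes room for
    the window ending at [N + 1]. *)
Lemma decrease_upper_bound (rho : R) (Px Py : 'M[R]_(lyap_dim N)) (px py : 'cV[R]_N.+1)
    (F1 F2 F3 : 'M[R]_K.+1) (eta etab : idx K -> idx K -> R) : (N < K)%N ->
  symmetric_mx F2 -> symmetric_mx F3 -> possemidef F2 -> possemidef F3 ->
  (forall i j, 0 <= eta i j /\ 0 <= etab i j) ->
  lyapunov Px Py px py (state_at a p q A x y (s + N).+1)
  - rho ^+ 2 * lyapunov Px Py px py (state_at a p q A x y (s + N))
  <= trq (delta_V rho Px (x_bar a K) N%:Z
        + \sum_i \sum_j eta i j *: interp_M mux Lx (ux_bar a K) i j
        - B_vx a K *m F1 *m (B_H R N K)^T - B_H R N K *m F2 *m (B_H R N K)^T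
        + Lxy ^+ 2 *: (B_vx a K *m F3 *m (B_vx a K)^T)) XiX
  + trq (delta_V rho Py (y_bar a K) N%:Z
        + \sum_i \sum_j etab i j *: interp_M muy Ly (uy_bar a K) i j
        + B_H R N K *m F1 *m (B_vy a K)^T
        + Lxy ^+ 2 *: (B_vy a K *m F2 *m (B_vy a K)^T)
        - B_H R N K *m F3 *m (B_H R N K)^T) XiY
  + ip (delta_v K rho px N%:Z + \sum_i \sum_j eta i j *: interp_m mux Lx i j) FX
  + ip (delta_v K rho py N%:Z + \sum_i \sum_j etab i j *: interp_m muy Ly i j) FY.
Proof.
move=> ltNK F2sym F3sym F2psd F3psd eta_ge0.
have [pF qF _] := fK; have [_ gp0 gq0 p0 q0] := fN.
have NK : (N <= N <= K)%N by rewrite leqnn ltnW.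
have SNK : (N <= N.+1 <= K)%N by rewrite leqnSn ltNK.
have etaX := interp_sum_ge0 (X := x) (U := ux a x) (H := hx a A y) pF gp0 p0 muLx
  ux_bar_lift (fun i j => proj1 (eta_ge0 i j)).
have etaY := interp_sum_ge0 (X := y) (U := uy a y) (H := hy a A x) qF gq0 q0 muLy
  uy_bar_lift (fun i j => proj2 (eta_ge0 i j)).
have := coupling_sum_le0 F1 F2sym F3sym F2psd F3psd.
rewrite !lyapunov_state_at -addnS.
rewrite -(half_lyapunov_lift (U := ux a x) x_bar_lift Px px NK).
rewrite -(half_lyapunov_lift (U := uy a y) y_bar_lift Py py NK).
rewrite -(half_lyapunov_lift (U := ux a x) x_bar_lift Px px SNK).
rewrite -(half_lyapunov_lift (U := uy a y) y_bar_lift Py py SNK).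
rewrite /delta_V /delta_v -!PoszD !addn1.
rewrite !(ipDl, ipNl, ipZl) !(trqD, trqN, trqZ).
move: etaX etaY; rewrite -/XiX -/XiY -/FX -/FY.
by lra.
Qed.

Lemma state_norm_sqr_le (k : nat) : (N <= k <= K)%N ->
  state_norm (state_at a p q A x y (s + k)) ^+ 2 <=
  ((enorm (window N (x_bar a K) k%:Z) ^+ 2 + enorm (window N (g_bar R N K) k%:Z) ^+ 2
    + enorm (window N (h_bar R N K) k%:Z) ^+ 2) * enorm XiX ^+ 2
   + enorm (window N (f_bar R K) k%:Z) ^+ 2 * (\sum_j FX j 0) ^+ 2)
  + ((enorm (window N (y_bar a K) k%:Z) ^+ 2 + enorm (window N (g_bar R N K) k%:Z) ^+ 2
    + enorm (window N (h_bar R N K) k%:Z) ^+ 2) * enorm XiY ^+ 2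
   + enorm (window N (f_bar R K) k%:Z) ^+ 2 * (\sum_j FY j 0) ^+ 2).
Proof.
move=> kNK; have [pF qF _] := fK; have [_ gp0 gq0 p0 q0] := fN.
have HX := half_state_le (U := ux a x) (H := hx a A y) x_bar_lift pF mux_ge0 gp0 p0 kNK.
have HY := half_state_le (U := uy a y) (H := hy a A x) y_bar_lift qF muy_ge0 gq0 q0 kNK.
rewrite /state_norm sqr_sqrtr; last by rewrite !addr_ge0 ?sqr_ge0.
apply: le_trans (lerD HX HY); rewrite /=; lra.
Qed.

End Run.

(** * Coercivity of the Lyapunov function and conclusion *)

Lemma ip_le0 (R : realType) (n : nat) (w F : 'cV[R]_n) :
  (forall i, w i 0 <= 0) -> (forall i, 0 <= F i 0) -> ip w F <= 0.
Proof.
move=> w_le0 F_ge0; rewrite ip_sum sumr_le0 // => i _.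
by rewrite big_ord1 mulr_le0_ge0.
Qed.

Lemma ip_pos_coercive (R : realType) (n : nat) (w : 'cV[R]_n) :
  (forall i, 0 < w i 0) -> exists2 c, 0 < c &
    forall F : 'cV[R]_n, (forall i, 0 <= F i 0) -> c * \sum_i F i 0 <= ip w F.
Proof.
move=> w_gt0; have V_ge0 i : 0 <= (w i 0)^-1 by rewrite invr_ge0 ltW.
have S_ge0 : 0 <= \sum_i (w i 0)^-1 by apply: sumr_ge0.
(* A positive lower bound for all entries of [w], also valid for [n = 0]. *)
exists (1 + \sum_i (w i 0)^-1)^-1 => [|F F_ge0]; first by rewrite invr_gt0; lra.
rewrite ip_sum mulr_sumr ler_sum // => i _; rewrite big_ord1.
rewrite ler_wpM2r // -[leRHS]invrK lef_pV2 ?posrE ?invr_gt0 //; last by lra.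
rewrite (bigD1 i) //= addrCA lerDl.
by rewrite addr_ge0 // sumr_ge0.
Qed.

Lemma state_norm_eq0 (R : realType) (N dx dy : nat) (xi : state R N dx dy) :
  state_norm xi ^+ 2 = 0 -> xi = zero_state R N dx dy.
Proof.
case: xi => X GX FX HX Y GY FY HY.
rewrite /state_norm sqr_sqrtr; last by rewrite !addr_ge0 ?sqr_ge0.
have := (sqr_ge0 (enorm X), sqr_ge0 (enorm GX), sqr_ge0 (enorm FX), sqr_ge0 (enorm HX)).
have := (sqr_ge0 (enorm Y), sqr_ge0 (enorm GY), sqr_ge0 (enorm FY), sqr_ge0 (enorm HY)).
move=> [[[? ?] ?] ?] [[[? ?] ?] ?] /= S0.
by rewrite /zero_state; congr State; apply: enorm_sqr_eq0; lra.
Qed.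

Lemma lyapunov_zero (R : realType) (N dx dy : nat) (Px Py : 'M[R]_(lyap_dim N))
    (px py : 'cV[R]_N.+1) : lyapunov Px Py px py (zero_state R N dx dy) = 0.
Proof.
by rewrite /lyapunov /stack3 !qform_tens_stack /trq /= !col_mx0 !mulmx0 !mxtrace0 !mxE !addr0.
Qed.

(** The squared norms of the two lift matrices and the sums of function values are each at most a
    multiple of [V]. The function values enter the state norm squared, hence the term in [V ^+ 2].
    The constants are chosen before the dimensions and the state. *)
Lemma lyapunov_coercive (R : realType) (N : nat) (mux muy Lx Ly Lxy : R)
    (a : method R N) (Px Py : 'M[R]_(lyap_dim N)) (px py : 'cV[R]_N.+1)
    (C1 C2 C3 : 'M[R]_N.+1) (lam lamb : idx N -> idx N -> R) :
  0 <= mux -> mux <= Lx -> 0 <= muy -> muy <= Ly -> 0 <= Lxy ->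
  symmetric_mx C2 -> symmetric_mx C3 -> possemidef C2 -> possemidef C3 ->
  (forall i j, 0 <= lam i j /\ 0 <= lamb i j) ->
  positivity_constraints a mux muy Lx Ly Lxy Px Py px py C1 C2 C3 lam lamb ->
  exists b c, [/\ 0 <= b, 0 <= c & forall dx dy (xi : state R N dx dy),
    generated_state mux muy Lx Ly Lxy a xi ->
    let V := lyapunov Px Py px py xi in
    0 <= V /\ state_norm xi ^+ 2 <= b * V + c * V ^+ 2].
Proof.
move=> mux0 muLx muy0 muLy Lxy0 C2s C3s C2p C3p lam0 [ZX ZY wX wY].
have [zx zx0 zxP] := posdef_coercive ZX; have [zy zy0 zyP] := posdef_coercive ZY.
have [cx cx0 cxP] := ip_pos_coercive wX; have [cy cy0 cyP] := ip_pos_coercive wY.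
pose bX := enorm (window N (x_bar a N) N%:Z) ^+ 2
  + enorm (window N (g_bar R N N) N%:Z) ^+ 2 + enorm (window N (h_bar R N N) N%:Z) ^+ 2.
pose bY := enorm (window N (y_bar a N) N%:Z) ^+ 2
  + enorm (window N (g_bar R N N) N%:Z) ^+ 2 + enorm (window N (h_bar R N N) N%:Z) ^+ 2.
pose bf := enorm (window N (f_bar R N) N%:Z) ^+ 2.
have bX0 : 0 <= bX by rewrite !addr_ge0 ?sqr_ge0.
have bY0 : 0 <= bY by rewrite !addr_ge0 ?sqr_ge0.
have bf0 : 0 <= bf by rewrite sqr_ge0.
exists (bX / zx + bY / zy), (bf / cx ^+ 2 + bf / cy ^+ 2); split.
- by rewrite addr_ge0 // divr_ge0 // ltW.
- by rewrite addr_ge0 // divr_ge0 ?sqr_ge0.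
move=> dx dy xi [p [q [A [x [y [k [fK fN run Nk ->]]]]]]] V.
have [pF qF _] := fK; have [_ gp0 gq0 p0 q0] := fN.
(* The bar system is started at time [k - N], so that its index [N] is time [k]. *)
have kE : k = (k - N + N)%N by rewrite subnK.
have := state_norm_sqr_le (k - N) mux0 muy0 fK fN run (K := N) (k := N).
rewrite leqnn => /(_ isT).
have := positivity_lower_bound (k - N) mux0 muLx muy0 muLy Lxy0 fK fN run
  Px Py px py C1 (leqnn N) C2s C3s C2p C3p lam0.
rewrite -kE -/V -/bX -/bY -/bf.
set XiX := lift_mx _ _ _ x _ _; set XiY := lift_mx _ _ _ y _ _.
set FX := fvals _ _ p _; set FY := fvals _ _ q _.
have FX0 := fvals_ge0 (K := N) (k - N) (ux a x) pF mux0 gp0 p0.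
have FY0 := fvals_ge0 (K := N) (k - N) (uy a y) qF muy0 gq0 q0.
have := zxP _ XiX; have := zyP _ XiY; have := cxP _ FX0; have := cyP _ FY0.
rewrite -!/(trq _ _) -/FX -/FY.
have : 0 <= \sum_i FX i 0 by apply: sumr_ge0.
have : 0 <= \sum_i FY i 0 by apply: sumr_ge0.
have := sqr_ge0 (enorm XiX); have := sqr_ge0 (enorm XiY).
move: (enorm XiX ^+ 2) (enorm XiY ^+ 2) (\sum_i FX i 0) (\sum_i FY i 0).
move=> ex ey sx sy ey0 ex0 sy0 sx0 h1 h2 h3 h4 h5 h6.
have ezx : 0 <= zx * ex by rewrite mulr_ge0 // ltW.
have ezy : 0 <= zy * ey by rewrite mulr_ge0 // ltW.
have csx : 0 <= cx * sx by rewrite mulr_ge0 // ltW.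
have csy : 0 <= cy * sy by rewrite mulr_ge0 // ltW.
split; first by lra.
apply: le_trans h6 _.
have V1 : ex <= V / zx by rewrite ler_pdivlMr //; lra.
have V2 : ey <= V / zy by rewrite ler_pdivlMr //; lra.
have V3 : sx ^+ 2 <= V ^+ 2 / cx ^+ 2.
  have H : sx <= V / cx by rewrite ler_pdivlMr //; lra.
  by rewrite -expr_div_n ler_sqr ?nnegrE // (le_trans sx0 H).
have V4 : sy ^+ 2 <= V ^+ 2 / cy ^+ 2.
  have H : sy <= V / cy by rewrite ler_pdivlMr //; lra.
  by rewrite -expr_div_n ler_sqr ?nnegrE // (le_trans sy0 H).
apply: le_trans (lerD (lerD (ler_wpM2l bX0 V1) (ler_wpM2l bf0 V3))
                      (lerD (ler_wpM2l bY0 V2) (ler_wpM2l bf0 V4))) _.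
by rewrite le_eqVlt; apply/orP; left; apply/eqP; ring.
Qed.

Theorem theorem7p2 (R : realType) (N : nat) (mux muy Lx Ly Lxy rho : R)
    (a : method R N) :
  0 <= mux -> mux <= Lx -> 0 <= muy -> muy <= Ly ->
  0 < Lx -> 0 < Ly -> 0 <= Lxy -> 0 <= rho -> rho <= 1 ->
  coeffs_normalized a ->
  lyap_sdp_feasible mux muy Lx Ly Lxy rho a ->
  exists (Px Py : 'M[R]_(lyap_dim N)) (px py : 'cV[R]_N.+1),
    [/\ symmetric_mx Px, symmetric_mx Py &
    forall dx dy : nat,
    [/\ (forall xi : state R N dx dy,
           generated_state mux muy Lx Ly Lxy a xi ->
           0 <= lyapunov Px Py px py xi),
        (forall xi : state R N dx dy,
           generated_state mux muy Lx Ly Lxy a xi ->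
           (lyapunov Px Py px py xi = 0 <-> xi = zero_state R N dx dy)),
        (forall M : R, exists r : R, forall xi : state R N dx dy,
           generated_state mux muy Lx Ly Lxy a xi ->
           r <= state_norm xi -> M <= lyapunov Px Py px py xi) &
        (forall (p : 'cV[R]_dx -> R) (q : 'cV[R]_dy -> R)
                (A : 'M[R]_(dy, dx))
                (x : int -> 'cV[R]_dx) (y : int -> 'cV[R]_dy),
           in_K mux muy Lx Ly Lxy p q A -> normalized p q A ->
           is_run a p q A x y ->
           forall k : nat, (N <= k)%N ->
           lyapunov Px Py px py (state_at a p q A x y k.+1)
             <= rho ^+ 2 * lyapunov Px Py px py (state_at a p q A x y k))]].
Proof.
move=> mux0 muLx muy0 muLy _ _ Lxy0 _ _ _.
move=> [Px [Py [px [py [C1 [C2 [C3 [F1 [F2 [F3 [lam [lamb [eta [etab]]]]]]]]]]]]]].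
move=> [[Pxs Pys] [_ C2s C3s C2p C3p] [_ F2s F3s F2p F3p] [lam0 eta0] [pos dec]].
have [b [c [b0 c0 coer]]] := lyapunov_coercive mux0 muLx muy0 muLy Lxy0
  C2s C3s C2p C3p lam0 pos.
exists Px, Py, px, py; split=> // dx dy; split.
- by move=> xi /coer [].
- move=> xi /coer [V0 nV]; split=> [VE|->]; last exact: lyapunov_zero.
  apply: state_norm_eq0; apply/eqP; rewrite eq_le sqr_ge0 andbT.
  by move: nV; rewrite VE expr0n !mulr0 addr0.
(* If [V < M], then [M > 0] and the squared norm is at most [b * M + c * M ^+ 2], which is
   impossible once the norm is at least 1 plus that quantity. *)
- move=> M; exists (1 + (b * `|M| + c * M ^+ 2)) => xi /coer [V0 nV] r_le.
  rewrite leNgt; apply/negP => VM.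
  have M0 : 0 < M by apply: le_lt_trans VM.
  move: r_le nV; rewrite gtr0_norm //.
  set V := lyapunov _ _ _ _ _ in V0 VM *; set r := b * M + c * M ^+ 2 => r_le nV.
  have Vr : b * V + c * V ^+ 2 <= r.
    by rewrite lerD // ler_wpM2l ?ler_sqr ?nnegrE // ?ltW.
  have r0 : 0 <= r by rewrite addr_ge0 // mulr_ge0 ?sqr_ge0 // ltW.
  by nra.
move=> p q A x y fK fN run k Nk; have [decX decY decx decy] := dec.
have [pF qF _] := fK; have [_ gp0 gq0 p0 q0] := fN.
(* With [K = N + 1] started at [k - N], the bar indices [N] and [N + 1] are the times [k] and
   [k + 1]. *)
have := decrease_upper_bound (k - N) mux0 muLx muy0 muLy Lxy0 fK fN run
  rho Px Py px py F1 (leqnn N.+1) F2s F3s F2p F3p eta0.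
rewrite subnK // => dV; rewrite -subr_le0; apply: le_trans dV _.
have FX0 := fvals_ge0 (K := N.+1) (k - N) (ux a x) pF mux0 gp0 p0.
have FY0 := fvals_ge0 (K := N.+1) (k - N) (uy a y) qF muy0 gq0 q0.
apply: le_trans (lerD (lerD (lerD (trq_le0 _ decX) (trq_le0 _ decY))
  (ip_le0 decx FX0)) (ip_le0 decy FY0)) _.
by rewrite !addr0.
Qed.
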